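(* Let $\vec H$ be a fixed oriented graph (with at least three vertices) whose underlying undirected graph $H$ is bipartite, and suppose $\vec H$ is not well-oriented. \begin{itemize} \item If some connected component of $H$ contains at least two non-well-oriented vertices of $\vec H$, or some connected component of $H$ contains a non-well-oriented vertex of $\vec H$ and a cycle, then $R^1_{2/3}(\textsc{Sub}(\vec H))=\Omega(n^2)$. \item Else, if $H$ is a forest, then $R^1_{2/3}(\textsc{Sub}(\vec H))=\tilde O(n)$. \item Otherwise, every connected component of $\vec H$ is either a well-oriented bipartite graph or a tree with exactly one non-well-oriented vertex, and $R^1_{2/3}(\textsc{Sub}(\vec H))=\tilde O(n^{2-1/\Delta'(H)})$. \end{itemize}
   Context: An oriented graph is a digraph in which each pair of vertices is joined by at most one arc; $H$ denotes the underlying undirected graph of $\vec H$. An oriented bipartite graph is well-oriented if there is a bipartition $A\sqcup B$ of its vertices such that every arc goes from $A$ to $B$. A vertex of $\vec H$ is non-well-oriented if both its in-degree and out-degree in $\vec H$ are non-zero. For bipartite $H$ with bipartition $A(H)\sqcup B(H)$, $\Delta'(H)=\min\{\max_{v\in A(H)}\deg_H(v),\max_{v\in B(H)}\deg_H(v)\}$. Insertion-only streaming model: the arcs of an $n$-vertex oriented input graph $\vec G$ arrive as a stream in arbitrary order; the algorithm knows $n$, makes $p$ passes, and has $S$ bits of memory. $\textsc{Sub}(\vec H)$: decide whether $\vec G$ contains $\vec H$ as a subgraph (respecting orientations), and if so output the vertex set of a copy. $R^p_{2/3}(\Pi)$ is the minimum space of a randomized $p$-pass streaming algorithm solving $\Pi$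 with success probability at least $2/3$. $\tilde O$ hides polylogarithmic factors in $n$; asymptotics as $n\to\infty$ with $\vec H$ fixed. *)

(* Defs.v *)
From mathcomp Require Import all_boot.
From Stdlib Require Import Reals.

Set Implicit Arguments.
Unset Strict Implicit.
Unset Printing Implicit Defensive.

Definition oriented (V : finType) (A : {set V * V}) : Prop :=
  forall x y : V, (x, y) \in A -> x != y /\ (y, x) \notin A.

Definition uadj (V : finType) (A : {set V * V}) : rel V :=
  fun x y => ((x, y) \in A) || ((y, x) \in A).

Definition bip_coloring (V : finType) (A : {set V * V}) (c : V -> bool) : Prop :=
  forall x y : V, (x, y) \in A -> c x != c y.

Definition is_bipartite (V : finType) (A : {set V * V}) : Prop :=
  exists c : V -> bool, bip_coloring A c.

Definition well_oriented (V : finType) (A : {set V * V}) : Prop :=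
  exists c : V -> bool, forall x y : V, (x, y) \in A -> c x && ~~ c y.

Definition nwo (V : finType) (A : {set V * V}) (v : V) : Prop :=
  (exists u, (u, v) \in A) /\ (exists w, (v, w) \in A).

Definition is_ucycle (V : finType) (A : {set V * V}) (cyc : seq V) : Prop :=
  ucycle (uadj A) cyc /\ 2 < size cyc.

Definition comp_has_cycle (V : finType) (A : {set V * V}) (u : V) : Prop :=
  exists cyc : seq V, is_ucycle A cyc /\ exists2 x, x \in cyc & connect (uadj A) u x.

Definition is_forest (V : finType) (A : {set V * V}) : Prop :=
  ~ exists cyc : seq V, is_ucycle A cyc.

Definition comp_ok (V : finType) (A : {set V * V}) (u : V) : Prop :=
  (exists c : V -> bool, forall x y : V, (x, y) \in A ->
       connect (uadj A) u x -> c x && ~~ c y)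
  \/ (~ comp_has_cycle A u /\
      exists v, [/\ connect (uadj A) u v, nwo A v &
                  forall w, connect (uadj A) u w -> nwo A w -> w = v]).

Definition udeg (V : finType) (A : {set V * V}) (v : V) : nat :=
  #|[set w | uadj A v w]|.

Definition Delta' (V : finType) (A : {set V * V}) (c : V -> bool) : nat :=
  minn (\max_(v | c v) udeg A v) (\max_(v | ~~ c v) udeg A v).

Definition copyb (V : finType) (n : nat) (HA : {set V * V})
    (GA : {set 'I_n * 'I_n}) (f : {ffun V -> 'I_n}) : bool :=
  injectiveb f && [forall p in HA, (f p.1, f p.2) \in GA].

Definition correctb (V : finType) (n : nat) (HA : {set V * V})
    (GA : {set 'I_n * 'I_n}) (o : option {set 'I_n}) : bool :=
  match o with
  | Some X => [exists f : {ffun V -> 'I_n}, copyb HA GA f && (X == f @: [set: V])]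
  | None => ~~ [exists f : {ffun V -> 'I_n}, copyb HA GA f]
  end.

(* A deterministic one-pass streaming algorithm for n-vertex inputs with S bits
   of memory: memory states are 'I_(2^S); it reads arcs (u,v) one at a time. *)
Record detalg (n S : nat) := DetAlg {
  da_init : 'I_(2 ^ S);
  da_step : 'I_(2 ^ S) -> 'I_n * 'I_n -> 'I_(2 ^ S);
  da_out  : 'I_(2 ^ S) -> option {set 'I_n}
}.

Definition run (n S : nat) (a : detalg n S) (s : seq ('I_n * 'I_n)) : option {set 'I_n} :=
  da_out a (foldl (@da_step n S a) (da_init a) s).

(* A randomized algorithm: a (finitely supported) probability distribution over
   deterministic S-bit algorithms.  Since detalg n S is a finite set, this covers
   every probability distribution on it. *)
Definition randalg (n S : nat) := seq (R * detalg n S).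

Definition valid_dist (n S : nat) (mu : randalg n S) : Prop :=
  List.Forall (fun p => (0 <= fst p)%R) mu /\
  List.fold_right (fun p acc => (fst p + acc)%R) 0%R mu = 1%R.

Definition success_prob (V : finType) (n S : nat) (HA : {set V * V})
    (GA : {set 'I_n * 'I_n}) (s : seq ('I_n * 'I_n)) (mu : randalg n S) : R :=
  List.fold_right (fun p acc =>
    ((if correctb HA GA (run (snd p) s) then fst p else 0) + acc)%R) 0%R mu.

Definition solves (V : finType) (HA : {set V * V}) (n S : nat) : Prop :=
  exists mu : randalg n S, valid_dist mu /\
    forall GA : {set 'I_n * 'I_n}, oriented GA ->
    forall s : seq ('I_n * 'I_n), perm_eq s (enum GA) ->
      (2 / 3 <= success_prob HA GA s mu)%R.

(* Main.v *)
(* Lower bound, by reduction from INDEX.  Alice encodes k^2 bits as arcs between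
   two blocks; Bob adds a copy of H minus one arc (a, b), with a and b placed on the
   two endpoints he queries.  The result projects onto H, and all its
   non-well-oriented vertices lie in Bob's part.  If a component has two such
   vertices, (a, b) is taken on a shortest walk joining two of them; otherwise it is
   taken on a cycle as close as possible to such a vertex, and as short as possible,
   away from the attachment point.  By minimality, all walks (walks followed by a
   cycle) of this kind in the host stay in Bob's part, so without the queried arc
   there are fewer of them than in H.

   Upper bounds.  Keep an arc unless it closes, together with arcs already kept, a
   subgraph of minimum in- and out-degree > |V|.  Only O(n) arcs are kept, and a tree
   with at most one non-well-oriented vertex that uses a dropped arc can be re-embedded:
   the side of the arc without that vertex is alternating and embeds greedily in the
   dense subgraph.  If in addition the first O(n^(2 - 1/r)) arcs are kept, then either
   the whole input is stored or dependent random choice finds every well-oriented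
   component with one side of maximum degree r, avoiding any bounded set. *)
Require Import Defs.
From mathcomp Require Import all_boot zify.
From Stdlib Require Import Reals Lra Classical.
Import ssrnat.

Set Implicit Arguments.
Unset Strict Implicit.
Unset Printing Implicit Defensive.

(** * Patterns around non-well-oriented vertices *)

Lemma ex_min_classical (P : nat -> Prop) :
  (exists n, P n) -> exists2 n, P n & forall m, P m -> n <= m.
Proof.
case=> n; elim/ltn_ind: n => n IH Pn.
case: (classic (exists2 m, P m & m < n)) => [[m Pm lt_mn]|H]; first exact: IH Pm.
exists n => // m Pm; rewrite leqNgt; apply/negP => lt_mn; apply: H; by exists m.
Qed.

Lemma split_last (T : Type) (P : pred T) (s : seq T) :
  has P s -> exists s1 z s2, [/\ s = s1 ++ z :: s2, P z & all (predC P) s2].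
Proof.
elim/last_ind: s => [|s x IH] //; rewrite has_rcons.
have [Px _|Px /= /IH [s1 [z [s2 [-> Pz al]]]]] := boolP (P x).
  by exists s, x, [::]; rewrite cats1.
exists s1, z, (rcons s2 x); split=> //; first by rewrite rcons_cat.
by rewrite all_rcons /= Px.
Qed.

Lemma split_first (T : Type) (P : pred T) (s : seq T) :
  has P s -> exists s1 z s2, [/\ s = s1 ++ z :: s2, P z & all (predC P) s1].
Proof.
elim: s => [|x s IH] //=; have [Px _|Px /= /IH [s1 [z [s2 [-> Pz al]]]]] := boolP (P x).
  by exists [::], x, s.
by exists (x :: s1), z, s2; split=> //=; rewrite Px.
Qed.

Lemma shorten_exists (T : eqType) (e : rel T) x p : path e x p ->
  exists q, [/\ path e x q, last x q = last x p, uniq (x :: q) & {subset q <= p}].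
Proof. by case/shortenP => q; exists q. Qed.

Section Graph.
Variables (V : finType) (A : {set V * V}).
Implicit Types u v w : V.

Lemma uadj_sym : symmetric (uadj A).
Proof. by move=> x y; rewrite /uadj orbC. Qed.

Lemma connect_uadj_sym : connect_sym (uadj A).
Proof. by apply: sym_connect_sym uadj_sym. Qed.

Definition nwob v := [exists u, (u, v) \in A] && [exists w, (v, w) \in A].

Lemma nwoP v : reflect (nwo A v) (nwob v).
Proof.
apply: (iffP andP) => [[/existsP ? /existsP ?]|[[u ?] [w ?]]]; first by split.
by split; apply/existsP; [exists u|exists w].
Qed.

Lemma cycle_of_path w x p :
    path (uadj A) x p -> w \notin x :: p -> uadj A w x -> uadj A (last x p) w ->
    x != last x p ->
  exists cyc, [/\ is_ucycle A cyc, w \in cyc & x \in cyc].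
Proof.
move=> pth wp wx lw neq; move: lw neq; case/shortenP: pth => q pth uq sub lw neq.
exists [:: w, x & q]; split; rewrite ?inE ?eqxx ?orbT //; split.
  rewrite /ucycle /cycle rcons_path /= in pth lw *.
  rewrite wx pth lw /=; move: uq => /= ->; rewrite andbT.
  apply: contra wp; rewrite !inE => /orP[->//|/sub ->]; by rewrite orbT.
by case: q neq {pth uq sub lw} => [|? ?] //=; rewrite eqxx.
Qed.

Lemma cycle_of_connect w x z :
    let e := [rel y y' | [&& uadj A y y', y != w & y' != w]] in
    connect e x z -> uadj A w x -> uadj A z w -> x != z -> w != x ->
  exists cyc, [/\ is_ucycle A cyc, w \in cyc & x \in cyc].
Proof.
move=> e /connectP[p pth ->] wx zw neq wnx.
apply: (cycle_of_path (p := p)) => //.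
  by apply: sub_path pth => ? ? /and3P[].
rewrite inE negb_or wnx /=.
elim: p x pth {zw neq wx wnx} => //= y p IH x /andP[/and3P[_ _ yw] pth].
by rewrite inE negb_or eq_sym yw (IH _ pth).
Qed.

Lemma cycle_rot_at cyc w : is_ucycle A cyc -> w \in cyc ->
  exists c, is_ucycle A (w :: c) /\ size (w :: c) = size cyc.
Proof.
move=> [/andP[cy un] sz] wc; case: (rot_to wc) => i c ec.
exists c; rewrite -ec size_rot; split=> //; split; last by rewrite size_rot.
by rewrite /ucycle rot_cycle cy rot_uniq.
Qed.

End Graph.

(* The host graph [GA] projects onto [HA] by [phi]; [psi] is a section of [phi].
   Over the arc [(a, b)] it may have any arcs except [(psi a, psi b)], and over
   the other arcs it has nothing but their images under [psi]. *)
Section Host.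
Variables (V W : finType) (HA : {set V * V}) (GA : {set W * W}).
Variables (phi : W -> V) (psi : V -> W) (a b : V).
Hypothesis oriHA : oriented HA.
Hypothesis phiK : cancel psi phi.
Hypothesis abH : (a, b) \in HA.
Hypothesis GA_arc : forall x y, (x, y) \in GA ->
  (exists p q, [/\ (p, q) \in HA, (p, q) != (a, b), x = psi p & y = psi q])
  \/ [/\ phi x = a, phi y = b & (x, y) != (psi a, psi b)].

Let HA' := HA :\ (a, b).
(** Membership in the image of the section [psi]. *)
Let ins (z : W) := psi (phi z) == z.

Let ab : a != b. Proof. by case: (oriHA abH). Qed.

Let phi_hom x y : (x, y) \in GA -> (phi x, phi y) \in HA.
Proof.
case/GA_arc => [[p [q [pq _ -> ->]]]|[-> -> _]] //.
by rewrite !phiK.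
Qed.

Let phi_uadj x y : uadj GA x y -> uadj HA (phi x) (phi y).
Proof. by case/orP => /phi_hom; rewrite /uadj => ->; rewrite ?orbT. Qed.

Let phi_path x s : path (uadj GA) x s -> path (uadj HA) (phi x) (map phi s).
Proof. by rewrite path_map; apply: sub_path => ? ?; apply: phi_uadj. Qed.

Let ins_uadj x y : ins x -> ins y -> uadj GA x y -> uadj HA' (phi x) (phi y).
Proof.
move=> /eqP ix /eqP iy; have main u v : psi (phi u) = u -> psi (phi v) = v ->
    (u, v) \in GA -> (phi u, phi v) \in HA'.
  move=> iu iv /GA_arc [[p [q [pq ne -> ->]]]|[ea eb]].
    by rewrite !phiK in_setD1 ne.
  by rewrite -{1}iu -{1}iv ea eb eqxx.
by case/orP => /main h; rewrite /uadj h ?orbT.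
Qed.

Let out_arc z w : ~~ ins z -> uadj GA z w ->
  (phi z = a /\ phi w = b) \/ (phi z = b /\ phi w = a).
Proof.
move=> oz /orP[] /GA_arc [[p [q [_ _ e1 e2]]]|[e1 e2 _]]; try by [left|right].
  by move: oz; rewrite /ins e1 phiK eqxx.
by move: oz; rewrite /ins e2 phiK eqxx.
Qed.

(** All arcs at [z] lie over [(a, b)], and [z] itself lies over only one of its ends. A walk through
    [z] therefore folds back in the projection. *)
Let out_nbrs z w w' : ~~ ins z -> uadj GA z w -> uadj GA z w' -> phi w = phi w'.
Proof.
move=> oz /(out_arc oz)[[e1 e2]|[e1 e2]] /(out_arc oz)[[e3 e4]|[e3 e4]];
  rewrite ?e2 ?e4 //; by case/eqP: ab; rewrite -?e1 -?e3 // e1.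
Qed.

(** Otherwise an in-neighbour and an out-neighbour would project to the same vertex, and [HA] would
    contain an arc and its reverse. *)
Let nwo_ins z : nwo GA z -> ins z.
Proof.
move=> [[u uz] [w zw]]; apply/negPn/negP => oz.
have zu : uadj GA z u by rewrite /uadj uz orbT.
have zw' : uadj GA z w by rewrite /uadj zw.
have e := out_nbrs oz zu zw'.
have h1 := phi_hom uz; have h2 := phi_hom zw; rewrite e in h1.
by case: (oriHA h1); rewrite h2.
Qed.

Let nwo_phi z : nwo GA z -> nwo HA (phi z).
Proof. by move=> [[u /phi_hom uz] [w /phi_hom zw]]; split; [exists (phi u)|exists (phi w)]. Qed.

Variable f : V -> W.
Hypothesis finj : injective f.
Hypothesis fhom : forall x y, (x, y) \in HA -> (f x, f y) \in GA.

Let f_uadj x y : uadj HA x y -> uadj GA (f x) (f y).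
Proof. by case/orP => /fhom; rewrite /uadj => ->; rewrite ?orbT. Qed.

Let f_path x s : path (uadj HA) x s -> path (uadj GA) (f x) (map f s).
Proof. by rewrite path_map; apply: sub_path => ? ?; apply: f_uadj. Qed.

Let f_nwo v : nwo HA v -> nwo GA (f v).
Proof. by move=> [[u /fhom uz] [w /fhom zw]]; split; [exists (f u)|exists (f w)]. Qed.

Let phif_path x s : path (uadj HA) x s ->
  path (uadj HA) (phi (f x)) (map (phi \o f) s).
Proof. by move=> /f_path /phi_path; rewrite -map_comp. Qed.

Let f_insK x y : ins (f x) -> phi (f x) = phi (f y) -> ins (f y) -> x = y.
Proof. by move=> /eqP ix e /eqP iy; apply: finj; rewrite -ix -iy e. Qed.

(* A copy [f] lets [phi \o f] act on the patterns; staying inside the image of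
   [psi] makes this action injective, hence surjective since patterns are finite. *)
Lemma pattern_absurd k (P : pred (seq V)) (s0 : seq V) :
    (forall s, P s -> size s = k) -> P s0 ->
    (forall s, P s -> all ins (map f s)) ->
    (forall s, P s -> P (map (phi \o f) s)) ->
    (forall s, P s -> s0 <> map (phi \o f) s) ->
  False.
Proof.
move=> Psz Ps0 Pins PP Pne.
pose S := [set t : k.-tuple V | P t].
pose g (t : k.-tuple V) := [tuple of map (phi \o f) t].
have ginj : {in S &, injective g}.
  move=> s t; rewrite !inE => Ps Pt /(congr1 val) /= e.
  apply: val_inj => /=; apply: (inj_map finj).
  have idp u : all ins (map f u) -> map f u = map psi (map (phi \o f) u).
    move=> al; rewrite -map_comp; apply/eq_in_map => x xu /=; apply/esym/eqP.
    by move/allP: al; apply; apply: map_f.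
  by rewrite (idp _ (Pins _ Ps)) (idp _ (Pins _ Pt)) e.
have sz0 : size s0 == k by rewrite Psz.
have sub : g @: S \subset S :\ Tuple sz0.
  apply/subsetP => x /imsetP[t]; rewrite inE => Pt ->.
  rewrite !inE PP // andbT; apply/eqP => /(congr1 val) /= /esym; exact: Pne.
have := subset_leq_card sub; rewrite card_in_imset //.
rewrite (cardsD1 (Tuple sz0) S) inE Ps0; lia.
Qed.

Let path_split x s z : path (uadj GA) x s -> z \in s -> z != last x s ->
  exists y y' s1 s2, [/\ x :: s = s1 ++ [:: y, z, y' & s2], uadj GA z y & uadj GA z y'].
Proof.
move=> pth zs; case/splitPr: zs pth => p1 p2; rewrite cat_path /= last_cat /=.
case: p2 => [|y' p2] /=; first by rewrite eqxx.
case/and3P => _ yz /andP[zy' _] _.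
exists (last x p1), y', (belast x p1), p2; split=> //; last by rewrite uadj_sym.
by rewrite -cat_cons lastI cat_rcons.
Qed.

(** The patterns are walks of the minimal length [d] between distinct non-well-oriented vertices. A
    walk leaving the image of [psi] would project to one that repeats a vertex, and cutting out the
    repetition would beat [d]. *)
Lemma no_copy_two_nwo d (u0 : V) (s0 : seq V) :
    (forall u s, path (uadj HA) u s -> nwo HA u -> nwo HA (last u s) ->
       u != last u s -> d <= size s) ->
    path (uadj HA) u0 s0 -> nwo HA u0 -> nwo HA (last u0 s0) -> u0 != last u0 s0 ->
    size s0 = d ->
    ~~ path (uadj HA') u0 s0 ->
  False.
Proof.
move=> dmin pth0 nu0 nl0 ne0 sz0 npth0.
pose P t := if t is x :: s then [&& size s == d, path (uadj HA) x s,
  nwob HA x, nwob HA (last x s) & x != last x s] else false.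
have Pins t : P t -> all ins (map f t).
  case: t => //= x s /and5P[/eqP sz pth /nwoP nx /nwoP nl ne].
  have insx : ins (f x) by apply/nwo_ins/f_nwo.
  have lE : last (f x) (map f s) = f (last x s) by rewrite last_map.
  have insl : ins (last (f x) (map f s)) by rewrite lE; apply/nwo_ins/f_nwo.
  rewrite insx /=; apply/allP => z zs; apply/negPn/negP => oz.
  have zl : z != last (f x) (map f s) by apply: contra oz => /eqP ->.
  have [y [y' [s1 [s2 [e zy zy']]]]] := path_split (f_path pth) zs zl.
  have eyy' := out_nbrs oz zy zy'.
  have pthH := phi_path (f_path pth).
  suff: uniq (phi (f x) :: map phi (map f s)).
    by rewrite -map_cons e map_cat cat_uniq /= eyy' !inE eqxx orbT !andbF.
  have nxH := nwo_phi (f_nwo nx); have nlH := nwo_phi (f_nwo nl).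
  have neH : phi (f x) != phi (f (last x s)).
    apply: contra ne => /eqP e2; apply/eqP; apply: (f_insK insx e2).
    by rewrite -lE.
  have ll : last (phi (f x)) (map phi (map f s)) = phi (f (last x s)).
    by rewrite !last_map.
  have [q [pq lq uq sub]] := shorten_exists pthH; rewrite {}ll in lq.
  have dq := dmin _ _ pq nxH; rewrite lq in dq; have {dq} := dq nlH neH => dq.
  have szs : size (map phi (map f s)) = d by rewrite !size_map.
  (* The simple walk has at least [d] vertices after its start, all among the [d] entries of the
     projected walk, so that walk has no repetition either. *)
  move: uq; rewrite /= => /andP[xq uq].
  have us : uniq (map phi (map f s)) by apply: leq_size_uniq sub _; rewrite ?szs.
  rewrite us andbT; have [] := uniq_min_size uq sub; first by rewrite szs.
  by move=> _ <-.
apply: (@pattern_absurd d.+1 P (u0 :: s0)) => //.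
- by case=> //= x s /and5P[/eqP ->].
- rewrite /= sz0 eqxx pth0 ne0 /= andbT; apply/andP; split; exact/nwoP.
- move=> t Pt; have := Pins _ Pt; case: t Pt => //= x s.
  case/and5P => /eqP sz pth /nwoP nx /nwoP nl ne /andP[ix isl].
  rewrite size_map sz eqxx (map_comp phi f) (phi_path (f_path pth)) !last_map /=.
  apply/and3P; split.
  + exact/nwoP/nwo_phi/f_nwo.
  + exact/nwoP/nwo_phi/f_nwo.
  apply: contra ne => /eqP e; apply/eqP; apply: (f_insK ix e).
  exact/nwo_ins/f_nwo.
- move=> t Pt; have := Pins _ Pt; case: t Pt => //= x s.
  case/and5P => _ pth _ _ _ /andP[ix isl] [eu es]; case/negP: npth0.
  rewrite eu es (map_comp phi f) path_map.
  have al : all ins (f x :: map f s) by rewrite /= ix isl.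
  by apply: (sub_in_path _ al (f_path pth)) => ? ? ; apply: ins_uadj.
Qed.

(** The patterns are walks of length [d] from a non-well-oriented vertex to a cycle, followed by
    that cycle. The first hypothesis keeps the walk in the image of [psi]. If the cycle leaves it,
    the stretch from the first to the last vertex outside can be replaced, in the projection, by the
    arc [(a, b)], against the minimality of [l]. *)
Lemma no_copy_cycle d l (u0 : V) (p0 c0 : seq V) :
    (forall u p, path (uadj HA) u p -> nwo HA u -> size p <= d ->
       last u p != a /\ last u p != b) ->
    (forall u p c, path (uadj HA) u p -> nwo HA u -> size p = d ->
       is_ucycle HA (last u p :: c) -> l <= size c) ->
    nwo HA u0 -> path (uadj HA) u0 p0 -> size p0 = d ->
    is_ucycle HA (last u0 p0 :: c0) -> size c0 = l ->
    ~~ cycle (uadj HA') (last u0 p0 :: c0) ->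
  False.
Proof.
move=> far lmin nu0 pth0 szp0 [/andP[cyc0 uc0] sz3] szc0 ncyc0.
have l2 : 1 < l by rewrite -szc0; move: sz3.
pose P t := if t is u :: s then let p := take d s in let c := drop d s in
  [&& size s == d + l, path (uadj HA) u p, nwob HA u,
      cycle (uadj HA) (last u p :: c) & uniq (last u p :: c)] else false.
have ins_far z z' : uadj GA z z' -> phi z != a -> phi z != b -> ins z.
  move=> zz' za zb; apply/negPn/negP => oz.
  by case: (out_arc oz zz') => [[e _]|[e _]]; rewrite e eqxx in za zb.
have Pins t : P t -> all ins (map f t).
  case: t => // u s; rewrite /P; set p := take d s; set c := drop d s.
  case/and5P => /eqP sz pth /nwoP nu cyc un.
  have szp : size p = d by rewrite size_takel // sz leq_addr.
  have szc : size c = l by rewrite size_drop sz addKn.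
  have farp y : y \in u :: p -> phi (f y) != a /\ phi (f y) != b.
    rewrite inE => yup.
    have [p1 [pth1 <- sz1]] : exists p1, [/\ path (uadj HA) u p1, last u p1 = y & size p1 <= d].
      case/orP: yup => [/eqP ->|yp]; first by exists [::].
      case/splitPr: yp pth szp => p1 p2; rewrite cat_path /= => /and3P[h1 h2 _] szp.
      exists (rcons p1 y); rewrite rcons_path last_rcons h1 h2; split=> //.
      by rewrite -szp size_rcons size_cat /=; lia.
    have := far _ _ (phi_path (f_path pth1)) (nwo_phi (f_nwo nu)).
    by rewrite !last_map !size_map; apply.
  have nbr y : y \in u :: p -> exists y', uadj HA y y'.
    rewrite inE => /orP[/eqP ->|yp].
      by case: nu => _ [v uv]; exists v; rewrite /uadj uv.
    case/splitPr: yp pth => p1 p2; rewrite cat_path /= => /and3P[_ h _].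
    by exists (last u p1); rewrite uadj_sym.
  have insp y : y \in u :: p -> ins (f y).
    move=> yp; have [y' /f_uadj yy'] := nbr _ yp; have [] := farp _ yp.
    exact: ins_far yy'.
  have lp : last u p \in u :: p by apply: mem_last.
  set w := f (last u p).
  have insw : ins w by apply: insp.
  have [wa wb] := farp _ lp.
  suff insc : all ins (map f c).
    rewrite -[s](cat_take_drop d) -/p -/c -cat_cons map_cat all_cat insc andbT.
    by apply/allP => _ /mapP[y yp ->]; apply: insp.
  apply/negPn/negP; rewrite -has_predC.
  case/split_first => A [z [B [eC oz insA]]].
  have : has (predC ins) (z :: B) by apply/orP; left.
  case/split_last => C [z2 [D [eB oz2 insD]]].
  have {insA} insA : all ins A by apply: sub_all insA => ? /negPn.
  have {insD} insD : all ins D by apply: sub_all insD => ? /negPn.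
  have fcyc : path (uadj GA) w (rcons (map f c) w).
    by rewrite -map_rcons; apply: f_path.
  have fun_ : uniq (w :: map f c) by rewrite -map_cons map_inj_uniq.
  have pthA : path (uadj GA) w A.
    by move: fcyc; rewrite eC rcons_cat cat_path => /andP[].
  have yz : uadj GA (last w A) z.
    by move: fcyc; rewrite eC rcons_cat cat_path /= => /and3P[].
  have pthD : path (uadj GA) z2 (rcons D w).
    by move: fcyc; rewrite eC eB !rcons_cat !cat_path => /and3P[_ _] /= /andP[].
  have zy : uadj GA z (last w A) by rewrite uadj_sym.
  have portal z' v : ~~ ins z' -> uadj GA z' v -> (phi v == a) || (phi v == b).
    by move=> o h; case: (out_arc o h) => [[_ ->]|[_ ->]]; rewrite eqxx ?orbT.
  have py := portal _ _ oz zy.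
  (* The attachment vertex [w] projects to neither [a] nor [b], so it is not next to an outside
     vertex; [A] and [D] are nonempty and the shortened cycle keeps at least three vertices. *)
  case: A => [|y1 A] in eC insA pthA yz zy py *.
    by move: py; rewrite /= (negPf wa) (negPf wb).
  case: D => [|y2 D] in eB insD pthD *.
    case/andP: pthD => h _; have := portal _ _ oz2 h.
    by rewrite (negPf wa) (negPf wb).
  set y := last w (y1 :: A) in yz zy py.
  have z2y2 : uadj GA z2 y2 by case/andP: pthD.
  have py2 := portal _ _ oz2 z2y2.
  have un2 : uniq (w :: (y1 :: A) ++ y2 :: D).
    apply: subseq_uniq fun_; rewrite eC eB /= eqxx; case: eqP => // _.
    rewrite -[subseq _ _]/(subseq ((A ++ y2 :: D)) (A ++ C ++ z2 :: y2 :: D)).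
    apply: cat_subseq => //; rewrite -cat_rcons; exact: suffix_subseq.
  have yA : y \in y1 :: A by rewrite /y /= mem_last.
  have insy : ins y by apply: (allP insA).
  have insy2 : ins y2 by case/andP: insD.
  have yy2 : phi y != phi y2.
    apply/negP => /eqP e; have {}e : y = y2.
      by rewrite -(eqP insy) -(eqP insy2) e.
    move: un2; rewrite -cat_cons cat_uniq => /and3P[_ /hasPn /(_ y2) + _].
    by rewrite mem_head => /(_ isT) /negP; apply; rewrite -e inE yA orbT.
  have adj : uadj HA (phi y) (phi y2).
    move: yy2; case/orP: py => /eqP ->; case/orP: py2 => /eqP ->; rewrite ?eqxx // => _;
    by rewrite /uadj abH ?orbT.
  pose k := map phi ((y1 :: A) ++ y2 :: D).
  have cyck : is_ucycle HA (last (phi (f u)) (map phi (map f p)) :: k).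
    rewrite !last_map -/w -/(map phi (w :: _)) /k -map_cons; split; last first.
      by rewrite size_map /= size_cat /= addnS.
    rewrite /ucycle; apply/andP; split; last first.
      rewrite map_inj_in_uniq // => v v' /=.
      have al : all ins (w :: (y1 :: A) ++ y2 :: D) by rewrite /= all_cat insw insD andbT.
      by move=> /(allP al) /eqP i1 /(allP al) /eqP i2 e; rewrite -i1 -i2 e.
    rewrite map_cons /cycle -map_rcons rcons_cat map_cat cat_path; apply/andP; split.
      exact: phi_path pthA.
    rewrite last_map -/y /= adj /=.
    by apply: phi_path; case/andP: pthD.
  have := lmin _ _ _ (phi_path (f_path pth)) (nwo_phi (f_nwo nu)) _ cyck.
  rewrite !size_map szp => /(_ erefl); apply/negP; rewrite -ltnNge -szc.
  rewrite -(size_map f c) eC eB !size_cat /=; clear; lia.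
have Psplit u s : P (u :: s) -> [/\ s = take d s ++ drop d s, size (take d s) = d,
    size (drop d s) = l & {subset last u (take d s) :: drop d s <= u :: s}].
  case/and5P => /eqP sz _ _ _ _; rewrite cat_take_drop size_drop sz addKn.
  rewrite size_takel ?sz ?leq_addr //; split=> // v.
  rewrite -{3}(cat_take_drop d s) -cat_cons mem_cat inE => /orP[/eqP ->|->].
    by rewrite mem_last.
  by rewrite orbT.
apply: (@pattern_absurd (d + l).+1 P (u0 :: p0 ++ c0)) => //.
- by case=> //= x s /and5P[/eqP ->].
- rewrite /P size_cat szp0 szc0 eqxx -szp0 take_size_cat // drop_size_cat // pth0 cyc0 uc0.
  by rewrite andbT /=; apply/andP; split=> //; apply/nwoP.
- move=> t Pt; have := Pins _ Pt; case: t Pt => // u s Pt al.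
  have [es sz1 sz2 sub] := Psplit _ _ Pt.
  move: Pt; rewrite /P map_cons -!map_take -!map_drop !size_map.
  set p := take d s in es sz1 sub *; set c := drop d s in es sz2 sub *.
  case/and5P => -> pth /nwoP nu cyc un; rewrite [last _ _]last_map -map_cons.
  rewrite andTb; apply/and4P; split.
  + exact: phif_path.
  + exact/nwoP/nwo_phi/f_nwo.
  + by rewrite /cycle map_cons -map_rcons; apply: phif_path.
  rewrite map_inj_in_uniq // => v v' /sub vc /sub v'c e.
  by apply: (f_insK _ e); apply: (allP al); apply: map_f.
- move=> t Pt; have := Pins _ Pt; case: t Pt => // u s Pt al.
  have [es sz1 sz2 sub] := Psplit _ _ Pt; move: Pt; rewrite /P map_cons.
  set p := take d s in es sz1 sub *; set c := drop d s in es sz2 sub *.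
  rewrite es map_cat; case/and5P => _ _ _ cyc _ [eu] /eqP.
  rewrite eqseq_cat ?size_map ?szp0 // => /andP[/eqP ep /eqP ec].
  case/negP: ncyc0; rewrite eu ep ec last_map /cycle /= -map_rcons.
  rewrite (map_comp phi f) path_map.
  have al2 : all ins (f (last u p) :: map f (rcons c (last u p))).
    rewrite -map_cons -rcons_cons; apply/allP => _ /mapP[y + ->].
    rewrite mem_rcons inE => yin; apply: (allP al); apply/map_f/sub.
    by case/orP: yin => // /eqP ->; rewrite mem_head.
  by apply: (sub_in_path _ al2 (f_path cyc)) => ? ? ; apply: ins_uadj.
Qed.

End Host.

(** * The choice of the queried arc *)

Lemma connect_avoid (V : finType) (A : {set V * V}) (w x : V) p :
    path (uadj A) x p -> w \notin x :: p ->
  connect [rel y y' | [&& uadj A y y', y != w & y' != w]] x (last x p).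
Proof.
elim: p x => [|y p IH] x /=; first by rewrite connect0.
case/andP=> xy pth; rewrite inE negb_or => /andP[wx wp].
apply: connect_trans (IH _ pth wp); apply: connect1 => /=.
by rewrite xy eq_sym wx; move: wp; rewrite inE negb_or eq_sym => /andP[].
Qed.

Lemma path_prefix (T : eqType) (e : rel T) x p y : path e x p -> y \in x :: p ->
  exists q, [/\ path e x q, last x q = y & (size q < size p) || (last x p == y)].
Proof.
move=> pth; rewrite inE => /orP[/eqP ->|yp].
  by exists [::]; split=> //; case: p {pth} => [|? ?] //=; rewrite eqxx.
case/splitPr: yp pth => p1 p2; rewrite cat_path /= => /and3P[h1 h2 _].
exists (rcons p1 y); rewrite rcons_path last_rcons h1 h2; split=> //.
rewrite last_cat size_rcons size_cat /=; case: p2 => [|v p2] /=; first by rewrite eqxx orbT.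
by rewrite addnS ltnS -addn1 leq_add.
Qed.

Lemma uadj_del (V : finType) (A : {set V * V}) a b : oriented A -> (a, b) \in A ->
  ~~ uadj (A :\ (a, b)) a b.
Proof.
move=> oriA /oriA [_ ba]; rewrite /uadj !in_setD1 eqxx /=.
by rewrite (negPf ba) andbF.
Qed.

Lemma uadj_arc (V : finType) (A : {set V * V}) x y : oriented A -> uadj A x y ->
  exists a b, [/\ (a, b) \in A, (a = x /\ b = y) \/ (a = y /\ b = x) &
    ~~ uadj (A :\ (a, b)) x y].
Proof.
move=> oriA /orP[xy|yx].
  by exists x, y; split=> //; [left|apply: uadj_del].
by exists y, x; split=> //; [right|rewrite uadj_sym; apply: uadj_del].
Qed.

(* Walks of length [d] from [u] to two vertices [w]
   and [x] of a cycle would enclose, together with the cycle, a cycle through a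
   vertex at distance less than [d] from [u]. *)
Lemma nearest_on_cycle (V : finType) (A : {set V * V}) d u p q c x :
    (forall q' c', path (uadj A) u q' -> is_ucycle A (last u q' :: c') -> d <= size q') ->
    path (uadj A) u p -> size p = d -> is_ucycle A (last u p :: c) ->
    path (uadj A) u q -> size q = d -> last u q = x -> x \in c ->
  False.
Proof.
move=> dmin; case/lastP: p => [|p w].
  move=> _ <- [/andP[_ un] _] _ /eqP; rewrite size_eq0 => /eqP -> /= <- uc.
  by move: un; rewrite /= uc.
rewrite last_rcons size_rcons rcons_path => /andP[pthp pw] szp ucyc pthq szq lq xc.
have [/andP[cyc un] sz3] := ucyc.
have notw q' : path (uadj A) u q' -> last u q' = w -> d <= size q'.
  by move=> h e; apply: (dmin _ c) => //; rewrite e.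
have wp : w \notin u :: p.
  apply/negP => /(path_prefix pthp) [q' [h1 h2 h3]].
  have := notw _ h1 h2; rewrite -szp.
  case/orP: h3 => [|/eqP e]; first by move=> h /(ltn_trans h); rewrite ltnn.
  by have := notw _ pthp e; rewrite -szp ltnn.
have xw : x != w by apply: contraL xc => /eqP ->; case/andP: un.
have wq : w \notin u :: q.
  apply/negP => /(path_prefix pthq) [q' [h1 h2 h3]].
  have := notw _ h1 h2; rewrite -szq.
  case/orP: h3 => [|/eqP e]; first by move=> h /(leq_ltn_trans) /(_ h); rewrite ltnn.
  by move: xw; rewrite -lq e eqxx.
set y := last u p in pw.
(* [y] is reached by a walk shorter than [d], so minimality keeps it off all cycles. *)
have yfree cyc' : is_ucycle A cyc' -> y \notin cyc'.
  move=> h; apply/negP => /(cycle_rot_at h) [c' [h' _]].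
  by have := dmin _ _ pthp h'; rewrite -szp ltnn.
have := yfree _ ucyc; rewrite inE negb_or => /andP[yw yc].
move: cyc; rewrite /cycle rcons_path => /andP[pthc zw].
case/splitPr: xc yc un pthc zw {ucyc sz3} => c1 c2 yc un pthc zw.
have wc : w \notin x :: c2.
  by move: un; rewrite cons_uniq mem_cat negb_or => /andP[/andP[_ ]].
have cx : path (uadj A) x c2 by move: pthc; rewrite cat_path /= => /and3P[].
rewrite last_cat /= in zw.
(* The route from [y] back to [u], on to [x] and along the cycle ends at a cycle neighbour of [w]
   and avoids [w]; closed through [w], it gives a cycle containing [y]. *)
have [|||||cy [h1 _ h2]] := @cycle_of_connect _ A w y (last x c2).
- apply: connect_trans (connect_avoid cx wc).
  rewrite -lq; apply: connect_trans (connect_avoid pthq wq).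
  rewrite (_ : connect _ y u = connect [rel y y' | [&& uadj A y y', y != w & y' != w]] u y).
    exact: connect_avoid.
  by apply: sym_connect_sym => ? ? /=; rewrite uadj_sym [(_ != w) && _]andbC.
- by rewrite uadj_sym.
- by [].
- by apply: contraNneq yc => ->; rewrite mem_cat mem_last orbT.
- by rewrite eq_sym.
by have := yfree _ h1; rewrite h2.
Qed.

Lemma hard_arc (V : finType) (HA : {set V * V}) : oriented HA ->
    (exists u v : V, [/\ u != v, nwo HA u, nwo HA v & connect (uadj HA) u v])
    \/ (exists u : V, nwo HA u /\ comp_has_cycle HA u) ->
  exists a b, (a, b) \in HA /\
    forall (W : finType) (GA : {set W * W}) (phi : W -> V) (psi : V -> W),
      cancel psi phi ->
      (forall x y, (x, y) \in GA ->
        (exists p q, [/\ (p, q) \in HA, (p, q) != (a, b), x = psi p & y = psi q])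
        \/ [/\ phi x = a, phi y = b & (x, y) != (psi a, psi b)]) ->
    forall f : V -> W, injective f ->
      ~ (forall x y, (x, y) \in HA -> (f x, f y) \in GA).
Proof.
move=> oriHA case1.
case: (classic (exists u v : V, [/\ u != v, nwo HA u, nwo HA v & connect (uadj HA) u v])).
  case=> u [v [uv nu nv /connectP[s pth ev]]].
  pose Q d := exists u s, [/\ path (uadj HA) u s, nwo HA u, nwo HA (last u s),
    u != last u s & size s = d].
  have exQ : exists d, Q d by exists (size s), u, s; rewrite -ev.
  have [d [u0 [s0 [pth0 nu0 nl0 ne0 sz0]]] dmin] := ex_min_classical exQ.
  case: s0 pth0 nl0 ne0 sz0 => [|x s0] pth0 nl0 ne0 sz0; first by rewrite eqxx in ne0.
  have [a [b [abH _ nab]]] := uadj_arc oriHA (proj1 (andP pth0)).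
  exists a, b; split=> // W GA phi psi phiK GAarc f finj fhom.
  apply: (@no_copy_two_nwo _ _ _ _ _ _ _ _ oriHA phiK abH GAarc _ finj fhom d u0 (x :: s0)) => //.
    by move=> u' s' *; apply: dmin; exists u', s'.
  by rewrite /= (negPf nab).
move=> ntwo.
have uniq_nwo u v : nwo HA u -> nwo HA v -> connect (uadj HA) u v -> u = v.
  move=> nu nv uv; apply/eqP/negPn/negP => ne; apply: ntwo; by exists u, v.
case: case1 => // -[u [nu [cyc [ucyc [x xc /connectP[p pth ex]]]]]].
(* First the distance [d] to a cycle is minimised, then the cycle length among the cycles at that
   distance. *)
pose Q d := exists u p c, [/\ path (uadj HA) u p, nwo HA u, size p = d &
  is_ucycle HA (last u p :: c)].
have exQ : exists d, Q d.
  by have [c [ucy _]] := cycle_rot_at ucyc xc; exists (size p), u, p, c; rewrite -ex.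
have {exQ} [d exd dmin] := ex_min_classical exQ.
pose Q' l := exists u p c, [/\ path (uadj HA) u p, nwo HA u, size p = d,
  is_ucycle HA (last u p :: c) & size c = l].
have exQ' : exists l, Q' l by case: exd => u' [p' [c' [? ? ? ?]]]; exists (size c'), u', p', c'.
have [l [u0 [p0 [c0 [pth0 nu0 szp0 ucy0 szc0]]]] lmin] := ex_min_classical exQ'.
have far u' p' x' : path (uadj HA) u' p' -> nwo HA u' -> size p' <= d -> x' \in c0 ->
    last u' p' != x'.
  move=> pth' nu' sz' xc'; apply/eqP => ex'.
  have ucx : x' \in last u0 p0 :: c0 by rewrite inE xc' orbT.
  have [c' [ucy' _]] := cycle_rot_at ucy0 ucx.
  have szp' : size p' = d.
    by apply/eqP; rewrite eqn_leq sz'; apply: dmin; exists u', p', c'; rewrite ex'.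
  (* Uniqueness within the component makes both walks start at the same vertex, as
     [nearest_on_cycle] requires. *)
  have eu : u' = u0.
    apply: uniq_nwo => //; apply: connect_trans (_ : connect _ x' u0).
      by apply/connectP; exists p'.
    rewrite connect_uadj_sym; apply: (connect_trans (y := last u0 p0)).
      by apply/connectP; exists p0.
    have [/andP[/path_connect h _] _] := ucy0; apply: h.
    by rewrite inE mem_rcons inE xc' !orbT.
  subst u'; apply: (nearest_on_cycle _ pth0 szp0 ucy0 pth' szp' ex' xc').
  by move=> q' c'' h1 h2; apply: dmin; exists u0, q', c''.
(* A cycle has at least three vertices, so two consecutive ones avoid the attachment point; the arc
   between them is chosen. *)
case: c0 ucy0 szc0 far => [|c1 [|c2 c0]] ucy0 szc0 far; try by case: ucy0.
have c12 : uadj HA c1 c2 by case: ucy0 => /andP[/and3P[]].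
have [a [b [abH eab nab]]] := uadj_arc oriHA c12.
exists a, b; split=> // W GA phi psi phiK GAarc f finj fhom.
apply: (@no_copy_cycle _ _ _ _ _ _ _ _ oriHA phiK abH GAarc _ finj fhom d l u0 p0
  [:: c1, c2 & c0]) => //.
- move=> u' p' h1 h2 h3; case: eab => [[-> ->]|[-> ->]]; split; apply: far => //;
  by rewrite !inE eqxx ?orbT.
- by move=> u' p' c' *; apply: lmin; exists u', p', c'.
- by rewrite /= (negPf nab) andbF.
Qed.

(** * Reduction from INDEX *)

Lemma INR_addn m n : INR (m + n) = (INR m + INR n)%R.
Proof. exact: plus_INR. Qed.

Lemma INR_muln m n : INR (m * n) = (INR m * INR n)%R.
Proof. exact: mult_INR. Qed.

Lemma INR_leq m n : m <= n -> (INR m <= INR n)%R.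
Proof. by move/leP; apply: le_INR. Qed.

(** A supporting line of slope [2 ^ t] at [t], written without subtraction; it comes from
    [e + 1 <= 2 ^ e]. *)
Lemma tangent_exp2 t g : 2 ^ t * g + 2 ^ t <= 2 ^ g + 2 ^ t * t.
Proof.
have [/subnKC <-|lt_gt] := leqP t g.
  rewrite expnD mulnDr -addnA addnC leq_add2r -{2}(muln1 (2 ^ t)) -mulnDr leq_mul2l.
  by rewrite addn1 ltn_expl // orbT.
by rewrite -mulnSr (leq_trans _ (leq_addl _ _)) // leq_mul2l lt_gt orbT.
Qed.

(** The sum factors over the coordinates; each contributes [2] for the agreeing bit and [1] for the
    other. *)
Lemma sum_exp2_agree (I : finType) (y : I -> bool) :
  \sum_(x : {ffun I -> bool}) 2 ^ #|[set i | y i == x i]| = 3 ^ #|I|.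
Proof.
under eq_bigr => x _.
  rewrite -sum1_card expn_sum (eq_bigl (fun i => y i == x i)); last by move=> i; rewrite inE.
  rewrite big_mkcond /=; over.
rewrite -(bigA_distr_bigA (fun i c => if y i == c then 2 ^ 1 else 1)) /=.
under eq_bigr => i _ do rewrite big_bool /=.
rewrite (eq_bigr (fun=> 3)); last by move=> i _; case: (y i).
by rewrite prod_nat_const.
Qed.

Section Averaging.
Variables (D X : Type) (ok : D -> X -> bool) (mu : seq (R * D)).
Local Open Scope R_scope.
Hypothesis mu_ge0 : List.Forall (fun p => 0 <= fst p) mu.
Hypothesis mu_sum : List.fold_right (fun p acc => fst p + acc) 0 mu = 1.

Let succ (x : X) : R :=
  List.fold_right (fun p acc => (if ok (snd p) x then fst p else 0) + acc) 0 mu.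

Let total (s : seq X) : R := List.fold_right (fun p acc =>
  fst p * INR (count (ok (snd p)) s) + acc) 0 mu.

(** The easy half of Yao's principle: some deterministic algorithm reaches the guaranteed fraction
    on the uniform distribution over [s]. *)
Lemma averaging (s : seq X) : (forall x, 2 / 3 <= succ x) ->
  exists d, (2 * size s <= 3 * count (ok d) s)%N.
Proof.
move=> succ_ge; apply: NNPP => Hno.
have tot_ge : 2 / 3 * INR (size s) <= total s.
  elim: s {Hno} => [|x s IH].
    rewrite /total /=; elim: (mu) => /= [|p l IH]; lra.
  have -> : total (x :: s) = succ x + total s.
    rewrite /total /succ; elim: (mu) => /= [|p l IHl]; first lra.
    rewrite IHl INR_addn; case: (ok p.2 x) => /=; lra.
  have := succ_ge x; rewrite [size _]/= S_INR; lra.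
(* Counts are integers, so falling short of two thirds means falling short by at least one third. *)
have tot_le : total s <= (2 * INR (size s) - 1) / 3.
  suff: forall l : seq (R * D), List.Forall (fun p => 0 <= fst p) l ->
      List.fold_right (fun p acc => fst p * INR (count (ok (snd p)) s) + acc) 0 l
      <= (2 * INR (size s) - 1) / 3 * List.fold_right (fun p acc => fst p + acc) 0 l.
    by move=> /(_ _ mu_ge0); rewrite mu_sum /total; lra.
  elim=> /= [_|p l IH /List.Forall_cons_iff [p0 /IH]]; first lra.
  have h : INR (count (ok p.2) s) <= (2 * INR (size s) - 1) / 3.
    have [hle|hlt] := leqP (2 * size s) (3 * count (ok p.2) s); first by case: Hno; exists p.2.
    move/INR_leq: hlt; rewrite S_INR !INR_muln /=; lra.
  have := Rmult_le_compat_l _ _ _ p0 h; lra.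
lra.
Qed.

End Averaging.

(* One-way communication bound for INDEX.  With [g x] the number of
   indices answered correctly on input [x], [2 ^ g x] is at most the sum over all
   messages [m] of [2 ^ agreement (x, answers to m)], so [2 ^ g] sums to at most
   [2 ^ S * 3 ^ N]; by convexity [g] cannot be [2 N / 3] on average. *)
Lemma index_bound (D : Type) (I M : finType) (S q : nat)
    (enc : D -> {ffun I -> bool} -> M) (dec : D -> M -> I -> bool) (mu : seq (R * D)) :
    #|M| = 2 ^ S -> #|I| = 9 * q ->
    List.Forall (fun p => (0 <= fst p)%R) mu ->
    List.fold_right (fun p acc => (fst p + acc)%R) 0%R mu = 1%R ->
    (forall x i, (2 / 3 <= List.fold_right (fun p acc =>
       ((if dec (snd p) (enc (snd p) x) i == x i then fst p else 0) + acc)%R) 0%R mu)%R) ->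
  q <= 2 * S.
Proof.
move=> cardM cardI mu0 mu1 succ.
pose ok d (p : {ffun I -> bool} * I) := dec d (enc d p.1) p.2 == p.1 p.2.
have [|d] := @averaging D _ ok mu mu0 mu1 (enum {: {ffun I -> bool} * I}).
  by case=> x i; apply: succ.
rewrite -cardE card_prod card_ffun card_bool -size_filter.
pose g (x : {ffun I -> bool}) := #|[set i | dec d (enc d x) i == x i]|.
have -> : size [seq p <- enum {: {ffun I -> bool} * I} | ok d p] = \sum_x g x.
  rewrite size_filter -sum1_count big_enum_cond /= -(pair_big_dep xpredT (fun x i => ok d (x, i)) (fun _ _ => 1)) /=.
  by apply: eq_bigr => x _; rewrite sum1_card; apply: eq_card => i; rewrite !inE.
have [N eN] : exists N, N = 9 * q by exists (9 * q).
(* The tangent is taken at two thirds of [N], the guaranteed average of [g]. *)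
have [t et] : exists t, t = 6 * q by exists (6 * q).
rewrite -eN in cardI; rewrite cardI => g_avg.
have up : \sum_x 2 ^ g x <= 2 ^ S * 3 ^ N.
  have -> : 2 ^ S * 3 ^ N = \sum_(m : M) \sum_(x : {ffun I -> bool})
      2 ^ #|[set i | dec d m i == x i]|.
    under eq_bigr => m _ do rewrite sum_exp2_agree.
    by rewrite sum_nat_const cardM cardI.
  rewrite exchange_big /=; apply: leq_sum => x _.
  by rewrite (bigD1 (enc d x)) //= leq_addr.
have low : 2 ^ t * \sum_x g x + 2 ^ t * 2 ^ N <= 2 ^ S * 3 ^ N + 2 ^ N * (2 ^ t * t).
  have : \sum_x (2 ^ t * g x + 2 ^ t) <= \sum_x (2 ^ g x + 2 ^ t * t).
    by apply: leq_sum => x _; apply: tangent_exp2.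
  rewrite !big_split /= -big_distrr /= !sum_nat_const card_ffun card_bool cardI.
  rewrite [2 ^ N * 2 ^ t]mulnC => /leq_trans; apply; by rewrite leq_add2r.
have avg : t * 2 ^ N <= \sum_x g x.
  move: g_avg; rewrite (_ : 2 * (2 ^ N * N) = 3 * (t * 2 ^ N)) ?leq_mul2l //.
  by rewrite eN et; nia.
have main : 2 ^ t * 2 ^ N <= 2 ^ S * 3 ^ N.
  rewrite -(leq_add2r (2 ^ N * (2 ^ t * t))); apply: leq_trans low.
  rewrite addnC leq_add2r mulnCA leq_mul2l mulnC avg orbT //.
(* Squaring reduces the comparison to [2 * 3 ^ 18 <= 2 ^ 30], which leaves a whole factor [2] per
   unit of [q]. *)
have sq : 2 ^ (t + N + (t + N)) <= 2 ^ (S + S) * 3 ^ (N + N).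
  by rewrite !expnD (mulnACA (2 ^ S)); apply: leq_mul.
have h : 2 ^ q * 3 ^ (N + N) <= 2 ^ (t + N + (t + N)).
  have -> : N + N = 18 * q by rewrite eN; lia.
  have -> : t + N + (t + N) = 30 * q by rewrite eN et; lia.
  have c : 2 * 3 ^ 18 <= 2 ^ 30 by clear; lia.
  rewrite (expnM 3) (expnM 2) -expnMn; move: (2 * _) (2 ^ 30) c => x y c.
  by case: (q) => // q'; rewrite leq_exp2r.
have : 2 ^ q <= 2 ^ (S + S).
  by rewrite -(leq_pmul2r (_ : 0 < 3 ^ (N + N))) ?expn_gt0 //; apply: leq_trans h sq.
by rewrite leq_exp2l // addnn mul2n.
Qed.

(* The statement's [2 ^ S] is [Nat.pow]. *)
Lemma pow_expn m n : Nat.pow m n = m ^ n.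
Proof. by elim: n => //= n ->; rewrite expnS. Qed.

Section Coding.
Variables (T : finType) (m : nat).
Hypothesis le_m : #|T| <= m.

(** Serves twice: to place the vertices of the host among the [n] input vertices, and to store a set
    of arcs as a memory state. *)
Definition code (t : T) : 'I_m := widen_ord le_m (enum_rank t).

Definition uncode (z : 'I_m) : option T :=
  omap enum_val (insub (val z) : option 'I_#|T|).

Lemma codeK t : uncode (code t) = Some t.
Proof. by rewrite /uncode /code /= valK /= enum_rankK. Qed.

Lemma code_inj : injective code.
Proof. by move=> t t' /(congr1 uncode); rewrite !codeK => -[]. Qed.

End Coding.

(** The two blocks have [3 * k] vertices each, hence [9 * k ^ 2] bits, the form that [index_bound]
    asks for with [q = k ^ 2]. *)
Lemma sub_lower_bound (V : finType) (HA : {set V * V}) k n S : oriented HA ->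
    (exists u v : V, [/\ u != v, nwo HA u, nwo HA v & connect (uadj HA) u v])
    \/ (exists u : V, nwo HA u /\ comp_has_cycle HA u) ->
    #|V| + 6 * k <= n -> solves HA n S ->
  k ^ 2 <= 2 * S.
Proof.
move=> oriHA /(hard_arc oriHA) [a [b [abH hard]]] le_n [mu [[mu0 mu1] succ]].
have le_n' : #|{: V + 'I_(3 * k) + 'I_(3 * k)}| <= n.
  by rewrite !card_sum !card_ord -addnA -mulnDl.
pose L i : 'I_n := code le_n' (inl (inr i)).
pose Rr j : 'I_n := code le_n' (inr j).
(* Vertices outside the coded ones are isolated, so their default value [a] is arbitrary. *)
pose phi (z : 'I_n) := match uncode (V + 'I_(3 * k) + 'I_(3 * k))%type z with
  | Some (inl (inl v)) => v | Some (inl (inr _)) => a | Some (inr _) => b | None => a end.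
pose psi (ij : 'I_(3 * k) * 'I_(3 * k)) v :=
  if v == a then L ij.1 else if v == b then Rr ij.2 else code le_n' (inl (inl v)).
have phiL i : phi (L i) = a by rewrite /phi codeK.
have phiR j : phi (Rr j) = b by rewrite /phi codeK.
have psiK ij : cancel (psi ij) phi.
  move=> v; rewrite /psi; case: eqP => [->|_] //; case: eqP => [->|_] //.
  by rewrite /phi codeK.
have ab : a != b by case: (oriHA _ _ abH).
have psia ij : psi ij a = L ij.1 by rewrite /psi eqxx.
have psib ij : psi ij b = Rr ij.2 by rewrite /psi eq_sym (negPf ab) eqxx.
pose alice (x : {ffun 'I_(3 * k) * 'I_(3 * k) -> bool}) : {set 'I_n * 'I_n} :=
  [set (L ij.1, Rr ij.2) | ij in [set ij | x ij]].
pose bob ij : {set 'I_n * 'I_n} := [set (psi ij e.1, psi ij e.2) | e in HA :\ (a, b)].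
pose G x ij := alice x :|: bob ij.
have aliceP x z w : (z, w) \in alice x -> exists2 ij, x ij & z = L ij.1 /\ w = Rr ij.2.
  by case/imsetP => ij; rewrite inE => xij [-> ->]; exists ij.
have aliceE x ij : ((L ij.1, Rr ij.2) \in alice x) = x ij.
  apply/idP/idP => [/aliceP [ij' xij [/code_inj [e1] /code_inj [e2]]]|xij].
    by rewrite (surjective_pairing ij) e1 e2 -surjective_pairing.
  by apply/imsetP; exists ij; rewrite ?inE.
have bobP ij z w : (z, w) \in bob ij ->
    exists p q, [/\ (p, q) \in HA, (p, q) != (a, b), z = psi ij p & w = psi ij q].
  by case/imsetP => -[p q]; rewrite in_setD1 => /andP[ne pq] [-> ->]; exists p, q.
have Ghom x ij z w : (z, w) \in G x ij -> (phi z, phi w) \in HA.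
  rewrite in_setU => /orP[/aliceP[ij' _ [-> ->]]|/bobP[p [q [pq _ -> ->]]]].
    by rewrite phiL phiR.
  by rewrite !psiK.
have Gori x ij : oriented (G x ij).
  move=> z w /Ghom zw; have [ne nwz] := oriHA _ _ zw; split.
    by apply: contra ne => /eqP ->.
  by apply: contra nwz; apply: Ghom.
(* The queried bit is the presence of the arc that completes Bob's copy; when it is absent,
   [hard_arc] excludes every copy. *)
have Gcopy x ij : [exists f : {ffun V -> 'I_n}, copyb HA (G x ij) f] = x ij.
  apply/existsP/idP => [[f /andP[/injectiveP finj /forallP fhom]]|xij].
    apply/negPn/negP => nx; apply: (hard _ (G x ij) phi (psi ij) (psiK ij) _ f finj).
      move=> z w; rewrite in_setU => /orP[zw|/bobP]; last by left.
      right; have [ij' xij' [ez ew]] := aliceP _ _ _ zw; rewrite ez ew phiL phiR; split=> //.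
      apply: contra nx => /eqP [e1 e2]; rewrite -aliceE -psia -psib -e1 -e2.
      by rewrite aliceE.
    by move=> p q pq; have /implyP := fhom (p, q); apply.
  exists (finfun (psi ij)); apply/andP; split.
    by apply/injectiveP => u v; rewrite !ffunE; apply: can_inj (psiK ij) _ _.
  apply/forallP => -[p q]; apply/implyP => pq /=; rewrite !ffunE in_setU.
  have [[-> ->]|ne] := (p, q) =P (a, b).
    by rewrite psia psib aliceE xij.
  apply/orP; right; apply/imsetP; exists (p, q) => //.
  by rewrite in_setD1 pq andbT; apply/eqP.
(* Alice's and Bob's arcs are disjoint, so reading hers first is a legal stream, and the state in
   between is the message. *)
have Gperm x ij : perm_eq (enum (alice x) ++ enum (bob ij)) (enum (G x ij)).
  apply: uniq_perm; rewrite ?enum_uniq //; last first.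
    by move=> e; rewrite mem_cat !mem_enum in_setU.
  rewrite cat_uniq !enum_uniq andbT /=; apply/hasPn => -[z w].
  rewrite !mem_enum => /bobP [p [q [_ ne ez ew]]]; apply/negP => /aliceP [ij' _ [ez' ew']].
  case/eqP: ne; rewrite -(psiK ij p) -(psiK ij q) -ez -ew ez' ew' phiL phiR //.
pose enc (d : detalg n S) x := foldl (@da_step n S d) (da_init d) (enum (alice x)).
pose dec (d : detalg n S) m ij := isSome (da_out d (foldl (@da_step n S d) m (enum (bob ij)))).
apply: (@index_bound _ _ _ S (k ^ 2) enc dec mu) => //.
  by rewrite card_ord pow_expn.
  by rewrite card_prod card_ord; lia.
move=> x ij; apply: Rle_trans (succ _ (Gori x ij) _ (Gperm x ij)) _.
rewrite /success_prob; elim: (mu) mu0 => [|[w d] l IH] /= mu0; first lra.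
move/List.Forall_cons_iff: mu0 => [/= w0 /IH h].
apply: Rplus_le_compat h; case: ifP => [ok|_]; last by case: ifP => _ /=; lra.
rewrite ifT; first lra.
move: ok; rewrite /dec /enc /run foldl_cat; case: (da_out _ _) => [X|] /=.
  by case/existsP => f /andP[cp _]; rewrite eq_sym eqb_id -(Gcopy x ij); apply/existsP; exists f.
by rewrite Gcopy; case: (x ij).
Qed.

(** * Re-embedding trees *)

Section Embedding.
Variables (V W : finType) (HA : {set V * V}).
Hypothesis oriHA : oriented HA.
Implicit Types (U T B : {set V}) (K Q : {set W * W}) (f : V -> W).

(* Arc-dependent targets [R] let [reembed] freeze the arcs away from the part it moves. *)
Definition pcopy U (R : V -> V -> {set W * W}) f : Prop :=
  {in U &, injective f} /\
  (forall x y, x \in U -> y \in U -> (x, y) \in HA -> (f x, f y) \in R x y).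

Definition upd f z w := fun x => if x == z then w else f x.

Lemma pcopy_upd U R f z w : pcopy U R f -> z \notin U -> w \notin f @: U ->
    (forall x, x \in U -> (x, z) \in HA -> (f x, w) \in R x z) ->
    (forall x, x \in U -> (z, x) \in HA -> (w, f x) \in R z x) ->
  pcopy (z |: U) R (upd f z w).
Proof.
move=> [finj farc] zU wU inz outz.
have updE x : x \in U -> upd f z w x = f x.
  by move=> xU; rewrite /upd; case: eqP => // e; rewrite -e xU in zU.
have updz : upd f z w z = w by rewrite /upd eqxx.
have wN x : x \in U -> f x != w.
  by move=> xU; apply: contraNneq wU => <-; apply: imset_f.
split=> x y; rewrite !in_setU1 => /predU1P[->|xU] /predU1P[->|yU]; rewrite ?updz ?updE //.
- by move=> e; case/eqP: (wN _ yU).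
- by move/eqP; rewrite (negPf (wN _ xU)).
- exact: finj.
- by move/oriHA => []; rewrite eqxx.
- exact: outz.
- exact: inz.
- exact: farc.
Qed.

(** Out-degree is demanded at tails and in-degree at heads only, which is all that an alternating
    tree needs. *)
Definition rich d Q := forall e, e \in Q ->
  d <= #|[set e' in Q | e'.1 == e.1]| /\ d <= #|[set e' in Q | e'.2 == e.2]|.

Lemma rich_out d Q (x y : W) (X : {set W}) : rich d Q -> (x, y) \in Q -> #|X| < d ->
  exists2 w, (x, w) \in Q & w \notin X.
Proof.
move=> rQ /rQ [/= dle _] ltX; apply: NNPP => H.
suff: #|[set e' in Q | e'.1 == x]| <= #|X| by rewrite leqNgt (leq_trans ltX).
rewrite -(card_in_imset (f := snd) (D := [set e' in Q | e'.1 == x])).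
  apply/subset_leq_card/subsetP => v /imsetP[[x' w]]; rewrite !inE => /andP[xw /eqP /= ex] ->.
  by rewrite ex in xw; apply/negPn/negP => wX; apply: H; exists w.
move=> [x1 w1] [x2 w2]; rewrite !inE => /andP[_ /eqP /= ->] /andP[_ /eqP /= ->] /= -> //.
Qed.

Lemma rich_in d Q (x y : W) (X : {set W}) : rich d Q -> (x, y) \in Q -> #|X| < d ->
  exists2 w, (w, y) \in Q & w \notin X.
Proof.
move=> rQ /rQ [_ /= dle] ltX; apply: NNPP => H.
suff: #|[set e' in Q | e'.2 == y]| <= #|X| by rewrite leqNgt (leq_trans ltX).
rewrite -(card_in_imset (f := fst) (D := [set e' in Q | e'.2 == y])).
  apply/subset_leq_card/subsetP => v /imsetP[[w y']]; rewrite !inE => /andP[xw /eqP /= ey] ->.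
  by rewrite ey in xw; apply/negPn/negP => wX; apply: H; exists w.
move=> [w1 x1] [w2 x2]; rewrite !inE => /andP[_ /eqP /= ->] /andP[_ /eqP /= ->] /= -> //.
Qed.

Lemma connect_exit (T : finType) (e : rel T) x y (B : {set T}) :
  connect e x y -> x \in B -> y \notin B -> exists w z, [/\ w \in B, z \notin B & e w z].
Proof.
case/connectP => p; elim: p x => [|v p IH] x /=; first by move=> _ -> ->.
case/andP => xv pth ey xB yB; have [vB|vB] := boolP (v \in B); last by exists x, v.
exact: IH pth ey vB yB.
Qed.

Lemma card_imset_lt f U z : z \notin U -> #|f @: U| < #|V|.
Proof.
move=> zU; apply: leq_ltn_trans (leq_imset_card _ _) _.
rewrite -cardsT; apply: proper_card; apply/properP; split; first exact: subsetT.
by exists z; rewrite ?in_setT.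
Qed.

Definition in_cycle v := exists2 cyc, is_ucycle HA cyc & v \in cyc.

(** [T] is the side of the edge between [rho] and [sigma] that has to move. None of its vertices has
    both in- and out-arcs, and it is placed greedily inside [Q], outward from [rho]; fewer than
    [#|V|] vertices are occupied at each step, so a free neighbour exists. *)
Lemma reembed U T (rho sigma : V) Q (R : V -> V -> {set W * W}) f0 (e : rel V) :
    T = [set z | connect e sigma z] -> subrel e (uadj HA) -> T \subset U ->
    rho \in U -> rho \notin T ->
    (forall z w, z \in T -> w \in U -> uadj HA z w -> w \in T \/ (w = rho /\ z = sigma)) ->
    (forall z, z \in T -> ~ nwo HA z) -> (forall z, z \in T -> ~ in_cycle z) ->
    rich #|V| Q -> uadj HA rho sigma ->
    ((rho, sigma) \in HA -> exists w, (f0 rho, w) \in Q) ->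
    ((sigma, rho) \in HA -> exists w, (w, f0 rho) \in Q) ->
    (forall x y, (x \in T) || (y \in T) -> Q \subset R x y) ->
    pcopy (U :\: T) R f0 ->
  exists f, pcopy U R f.
Proof.
move=> eT sub_e TU rhoU rhoT Tcl Tnwo Tcyc rQ rs rsQ srQ QR cp0.
have sT : sigma \in T by rewrite eT inE connect0.
(* [B] is the part already placed. It stays connected to [rho] within [rho |: B], and each vertex
   there with an arc to or from [T] has an image with an arc of [Q] in the same direction. *)
suff main m B f : #|T :\: B| = m -> B \subset T ->
    pcopy (U :\: T :|: B) R f ->
    (forall w, w \in B -> connect [rel x y | [&& uadj HA x y, x \in rho |: B & y \in rho |: B]] rho w) ->
    (forall w z, w \in rho |: B -> z \in T ->
       ((w, z) \in HA -> exists v, (f w, v) \in Q) /\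
       ((z, w) \in HA -> exists v, (v, f w) \in Q)) ->
    exists f, pcopy U R f.
  apply: (main _ set0 f0 (erefl _)); rewrite ?sub0set ?setU0 //.
    by move=> w; rewrite inE.
  move=> w z /set1P -> zT.
  have ez : uadj HA z rho -> z = sigma.
    by case/(Tcl z rho zT rhoU) => [rT|[]] //; rewrite rT in rhoT.
  split=> h.
    by apply: rsQ; rewrite -ez // /uadj h orbT.
  by apply: srQ; rewrite -ez // /uadj h.
elim: m B f => [|m IH] B f cardB BT cp conn J.
  exists f; suff -> : U = U :\: T :|: B by [].
  move/eqP: cardB; rewrite cards_eq0 setD_eq0 => TB.
  have -> : B = T by apply/eqP; rewrite eqEsubset BT.
  apply/setP => v; rewrite !inE; have /implyP := subsetP TU v.
  by case: (v \in T); case: (v \in U).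
set D := U :\: T :|: B in cp.
have [z [w [zT zB wB zw]]] : exists z w, [/\ z \in T, z \notin B, w \in rho |: B & uadj HA w z].
  have [sB|sB] := boolP (sigma \in B); last by exists sigma, rho; rewrite setU11.
  have [t tT tB] : exists2 t, t \in T & t \notin B.
    have : 0 < #|T :\: B| by rewrite cardB.
    by case/card_gt0P => t; rewrite inE => /andP[]; exists t.
  have st : connect e sigma t by move: tT; rewrite eT inE.
  have [w [z [wB zB wz]]] := connect_exit st sB tB.
  exists z, w; split=> //; [|by rewrite setU1r|exact: sub_e].
  move/subsetP/(_ _ wB): BT; rewrite eT !inE => /connect_trans; apply.
  exact: connect1.
have zD : z \notin D by rewrite !inE zT (negPf zB).
(* A second placed neighbour would close a cycle through [z], since [rho |: B] is connected without
   [z]. *)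
have nbrD x : x \in D -> uadj HA z x -> x = w.
  move=> xD zx; have xU : x \in U.
    by move: xD; rewrite !inE => /orP[/andP[]//|/(subsetP BT)/(subsetP TU)].
  have xB : x \in rho |: B.
    have [xT|[-> _]] := Tcl z x zT xU zx; last by rewrite setU11.
    by move: xD; rewrite !inE xT /= => ->; rewrite orbT.
  apply: NNPP => /eqP xw; apply: (Tcyc z zT).
  have zN : z \notin rho |: B.
    by rewrite in_setU1 negb_or zB andbT; apply: contraNneq rhoT => <-.
  set e' := [rel x y | _] in conn.
  have e'sym : connect_sym e'.
    by apply: sym_connect_sym => u v /=; rewrite uadj_sym [(u \in _) && _]andbC.
  have toR v : v \in rho |: B -> connect e' rho v.
    by case/setU1P => [->|/conn //]; rewrite connect0.
  have [|||||cyc [c1 c2 c3]] := @cycle_of_connect _ HA z w x; last by exists cyc.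
  - have : connect e' w x.
      by apply: connect_trans (toR _ xB); rewrite e'sym; apply: toR.
    apply: connect_sub => u v /= /and3P[uv uB vB]; apply: connect1 => /=.
    by rewrite uv andTb; apply/andP; split; [apply: contraTneq uB|apply: contraTneq vB] => ->.
  - by rewrite uadj_sym.
  - by rewrite uadj_sym.
  - by rewrite eq_sym.
  - by apply: contraNneq zN => ->.
have sz := card_imset_lt f zD.
have wz : w != z.
  by apply: contraTneq wB => ->; rewrite in_setU1 negb_or zB andbT; apply: contraNneq rhoT => <-.
have step h : h \notin f @: D ->
    ((w, z) \in HA -> (f w, h) \in Q) -> ((z, w) \in HA -> (h, f w) \in Q) ->
    exists f, pcopy U R f.
  move=> hD h1 h2; apply: (IH (z |: B) (upd f z h)).
  - move: cardB; rewrite (cardsD1 z) inE zB zT add1n => -[<-].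
    by congr #|pred_of_set _|; apply/setP => v; rewrite !inE negb_or andbA.
  - by rewrite subUset sub1set zT.
  - rewrite setUCA; apply: pcopy_upd => // x xD xz.
    + have exw : x = w by apply: nbrD; rewrite // /uadj xz orbT.
      rewrite exw in xz *; apply: (subsetP (QR w z _)); rewrite ?zT ?orbT //; exact: h1.
    + have exw : x = w by apply: nbrD; rewrite // /uadj xz.
      rewrite exw in xz *; apply: (subsetP (QR z w _)); rewrite ?zT ?orbT //; exact: h2.
  - have sub v v' : connect [rel x y | [&& uadj HA x y, x \in rho |: B & y \in rho |: B]] v v' ->
        connect [rel x y | [&& uadj HA x y, x \in rho |: (z |: B) & y \in rho |: (z |: B)]] v v'.
      apply: connect_sub => x y /= /and3P[xy xB yB]; apply: connect1 => /=.
      by rewrite xy setUCA !(setU1r z).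
    move=> v; case/setU1P => [->|/conn/sub //].
    apply: (connect_trans (y := w)).
      by case/setU1P: (wB) => [->|/conn/sub //]; rewrite connect0.
    by apply: connect1 => /=; rewrite zw setUCA setU11 setU1r.
  - move=> v z'; rewrite setUCA => /setU1P[->|vB] z'T; last first.
      rewrite /upd ifN; first exact: J.
      apply: contraTneq vB => ->; rewrite in_setU1 negb_or zB andbT.
      by apply: contraNneq rhoT => <-.
    (* Of the four combinations of directions at [z], two would make [z] non-well-oriented; in the
       others the arc just placed is the witness. *)
    rewrite /upd eqxx; case/orP: (zw) => a1; split=> a2.
    + by case: (Tnwo z zT); split; [exists w|exists z'].
    + by exists (f w); apply: h1.
    + by exists (f w); apply: h2.
    + by case: (Tnwo z zT); split; [exists z'|exists w].
have [Jo Ji] := J w z wB zT.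
case/orP: (zw) => a.
  have [v wv] := Jo a; have [h h1 h2] := rich_out rQ wv sz.
  by apply: (step h) => // a'; have [_] := oriHA a; rewrite a'.
have [v wv] := Ji a; have [h h1 h2] := rich_in rQ wv sz.
by apply: (step h) => // a'; have [_] := oriHA a; rewrite a'.
Qed.

(** A simple path from [q] back to [p] without the arc has an inner vertex, because orientation
    excludes the reverse arc; with the arc it closes to a cycle through [p]. *)
Lemma bridge p q : (p, q) \in HA -> ~ in_cycle p ->
  ~~ connect (uadj (HA :\ (p, q))) q p.
Proof.
move=> pq nocyc; apply/negP => /connectP[s0 pth0 e0]; apply: nocyc.
have [s [pth es un _]] := shorten_exists pth0; rewrite -e0 in es.
have del := uadj_del oriHA pq.
exists (q :: s); last by rewrite -es mem_last.
case: s pth es un => [|v s] pth es un.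
  by case: (oriHA pq); rewrite -es eqxx.
split; last first.
  case: s pth es un => // /andP[qv _] /= ev _.
  by move: qv; rewrite ev uadj_sym (negPf del).
rewrite /ucycle un andbT /cycle rcons_path es /uadj pq andbT.
apply: sub_path pth => x y; rewrite /uadj !in_setD1.
by case/orP => /andP[_ ->]; rewrite ?orbT.
Qed.

(* A dropped arc [(f p, f q)] is repaired by moving the side of [(p, q)] that has
   no non-well-oriented vertex into the rich set that made the arc redundant. *)
Lemma tree_kernel U (G K : {set W * W}) f :
    (forall z w, z \in U -> uadj HA z w -> w \in U) ->
    (forall z, z \in U -> ~ in_cycle z) ->
    (forall u v, u \in U -> nwo HA u -> nwo HA v -> connect (uadj HA) u v -> u = v) ->
    K \subset G ->
    (forall x y, (x, y) \in G -> (x, y) \notin K -> exists Q : {set W * W},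
       [/\ rich #|V| Q, Q \subset K, exists w, (x, w) \in Q & exists w, (w, y) \in Q]) ->
    pcopy U (fun _ _ => G) f ->
  exists f', pcopy U (fun _ _ => K) f'.
Proof.
move=> Ucl Ucyc Unwo KG redundant.
pose miss f := [set pq in HA | [&& pq.1 \in U, pq.2 \in U & (f pq.1, f pq.2) \notin K]].
have [m] := ubnP #|miss f|; elim: m f => // m IH f missm cp.
have [miss0|[[p q]]] := set_0Vmem (miss f).
  exists f; split=> [|x y xU yU xy]; first by case: cp.
  apply/negPn/negP => nK; suff : (x, y) \in miss f by rewrite miss0 inE.
  by rewrite inE xy xU yU.
move=> pqm; have := pqm; rewrite inE /= => /and4P[pq pU qU nK].
have [Q [rQ QK Qp Qq]] := redundant _ _ (proj2 cp _ _ pU qU pq) nK.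
pose e := uadj (HA :\ (p, q)).
have e_sym : connect_sym e by apply: connect_uadj_sym.
have sub_e : subrel e (uadj HA).
  by move=> x y; rewrite /e /uadj !in_setD1 => /orP[] /andP[_ ->]; rewrite ?orbT.
have sub_ce x y : connect e x y -> connect (uadj HA) x y.
  by apply: connect_sub => v w /sub_e; apply: connect1.
have con_U x y : x \in U -> connect (uadj HA) x y -> y \in U.
  move=> xU /connectP[s pth ->]; elim: s x xU pth => //= v s IHs x xU /andP[xv].
  by apply: IHs; apply: Ucl xv.
have nqp := bridge pq (Ucyc p pU).
have main rho sigma : (rho = p /\ sigma = q) \/ (rho = q /\ sigma = p) ->
    (forall z, connect e sigma z -> ~ nwo HA z) ->
    exists f', pcopy U (fun _ _ => K) f'.
  move=> ends Tnwo; set T := [set z | connect e sigma z].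
  have ncon : ~~ connect e sigma rho by case: ends => [[-> ->]|[-> ->]]; rewrite // e_sym.
  have adj : uadj HA rho sigma.
    by case: ends => [[-> ->]|[-> ->]]; rewrite /uadj pq ?orbT.
  have rU : rho \in U by case: ends => [[-> _]|[-> _]].
  have sU : sigma \in U by apply: Ucl adj.
  have TU : T \subset U.
    by apply/subsetP => z; rewrite inE => /sub_ce; apply: con_U.
  (* Arcs that avoid [T] must keep their exact image, so the move creates no new missing arc. *)
  pose R x y := if (x \in T) || (y \in T) then K else [set (f x, f y)].
  have [f' [f'inj f'arc]] : exists f', pcopy U R f'.
    apply: (@reembed U T rho sigma Q R f e) => //.
    - by rewrite inE.
    - move=> z w; rewrite !inE => sz _ zw.
      have [ezw|nezw] := boolP (e z w); first by left; apply: connect_trans sz (connect1 ezw).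
      have zwpq : (z = p /\ w = q) \/ (z = q /\ w = p).
        case/orP: zw => h.
          have [[-> ->]|/eqP ne] := (z, w) =P (p, q); first by left.
          by case/negP: nezw; rewrite /e /uadj !in_setD1 ne h.
        have [[-> ->]|/eqP ne] := (w, z) =P (p, q); first by right.
        by case/negP: nezw; rewrite /e /uadj !in_setD1 ne h orbT.
      have zr : z <> rho by move=> ez; case/negP: ncon; rewrite -ez.
      right; case: ends zr => [[-> ->]|[-> ->]]; by case: zwpq => [[-> ->]|[-> ->]].
    - by move=> z; rewrite inE; apply: Tnwo.
    - by move=> z /(subsetP TU); apply: Ucyc.
    - case: ends => [[-> ->]|[-> ->]] // h.
      by case: (oriHA pq); rewrite h.
    - case: ends => [[-> ->]|[-> ->]] // h.
      by case: (oriHA pq); rewrite h.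
    - by move=> x y h; rewrite /R h.
    split=> [x y|x y]; rewrite !in_setD.
      by case/andP => _ xU /andP[_ yU]; apply: (proj1 cp).
    case/andP => /negPf xT _ /andP[/negPf yT _] _; by rewrite /R xT yT inE.
  apply: (IH f').
    rewrite ltnS in missm; apply: leq_trans missm; rewrite (cardsD1 (p, q) (miss f)) pqm add1n ltnS.
    apply/subset_leq_card/subsetP => -[x y]; rewrite !inE /= => /and4P[xy xU yU].
    have := f'arc _ _ xU yU xy; rewrite /R; case: ifP => [_ ->//|/norP[xT yT]].
    rewrite inE => /eqP -> ->; rewrite xy xU yU !andbT.
    apply/eqP => -[ex ey]; case: ends => [[_ es]|[_ es]].
      by move: yT; rewrite ey inE es connect0.
    by move: xT; rewrite ex inE es connect0.
  split=> // x y xU yU xy; have := f'arc _ _ xU yU xy; rewrite /R.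
  case: ifP => _; first exact: (subsetP KG).
  by rewrite inE => /eqP ->; apply: (proj2 cp).
(* If the side of [q] holds a non-well-oriented vertex, uniqueness clears the side of [p], the two
   sides being disconnected without the arc. *)
have [[u qu nu]|noq] := classic (exists2 u, connect e q u & nwo HA u).
  apply: (main q p); first by right.
  move=> z pz nz; case/negP: nqp; apply: connect_trans (qu) _.
  suff -> : u = z by rewrite e_sym.
  apply: esym; apply: Unwo => //.
    exact: con_U (sub_ce _ _ pz).
  apply: (connect_trans (y := p)); first by apply: sub_ce; rewrite e_sym.
  apply: connect_trans (sub_ce _ _ qu); apply: connect1; by rewrite /uadj pq.
apply: (main p q); first by left.
by move=> z qz nz; apply: noq; exists z.
Qed.

End Embedding.

(** * Dependent random choice *)

(** Expanded form of [(a - b) * (a ^ k - b ^ k) >= 0], whose factors never have opposite signs. *)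
Lemma cross_power_le a b k : a * b ^ k + b * a ^ k <= a ^ k.+1 + b ^ k.+1.
Proof.
wlog le_ab : a b / a <= b.
  move=> h; case/orP: (leq_total a b) => [/h //|/h].
  by rewrite addnC (addnC (b ^ k.+1)).
have : a ^ k <= b ^ k by case: k => // k; rewrite leq_exp2r.
rewrite !expnS; move: (a ^ k) (b ^ k) => x y le_xy.
rewrite -(subnKC le_ab) -(subnKC le_xy); move: (b - a) (y - x) => c e; nia.
Qed.

(** Induction on the exponent by Chebyshev's sum inequality; both sides are doubled to symmetrise
    the double sum. *)
Lemma power_mean (W : finType) (d : W -> nat) r :
  (\sum_x d x) ^ r.+1 <= #|W| ^ r * \sum_x d x ^ r.+1.
Proof.
elim: r => [|r IH]; first by rewrite !expn1 mul1n.
rewrite expnS; apply: leq_trans (leq_mul (leqnn _) IH) _.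
rewrite mulnCA expnSr -mulnA leq_mul2l; apply/orP; right.
set k := r.+1.
have dbl : 2 * ((\sum_x d x) * (\sum_x d x ^ k)) = \sum_x \sum_y (d x * d y ^ k + d y * d x ^ k).
  under [RHS]eq_bigr => x _ do rewrite big_split /= -big_distrr -big_distrl /=.
  by rewrite big_split /= -big_distrl -big_distrr /= mul2n addnn.
have dbr : 2 * (#|W| * \sum_x d x ^ k.+1) = \sum_(x : W) \sum_(y : W) (d x ^ k.+1 + d y ^ k.+1).
  under [RHS]eq_bigr => x _ do rewrite big_split /= sum_nat_const.
  by rewrite big_split /= -big_distrr /= sum_nat_const mul2n addnn.
rewrite -(leq_pmul2l (_ : 0 < 2)) // dbl dbr.
by apply: leq_sum => x _; apply: leq_sum => y _; apply: cross_power_le.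
Qed.

Section DRC.
Variables (W : finType) (E : {set W * W}).

Definition common_out (I : finType) (z : I -> W) := [set y | [forall i, (z i, y) \in E]].

(* Pick [r'.+1] vertices at random and keep their common in-neighbourhood, deleting
   one vertex from each tuple that has few common out-neighbours. *)
Lemma dependent_random_choice r' m s : let r := r'.+1 in
    0 < #|W| -> (m ^ r + s) * #|W| ^ (r + r') <= #|E| ^ r ->
  exists U : {set W}, s <= #|U| /\
    forall z : {ffun 'I_r -> W}, (forall i, z i \in U) -> m <= #|common_out z|.
Proof.
move=> r W0 dense; set n := #|W| in W0 dense.
pose d x := #|[set y | (x, y) \in E]|.
have cardE : #|E| = \sum_x d x.
  rewrite -sum1_card (eq_bigl (fun p : W * W => true && ((p.1, p.2) \in E))); last by case.
  rewrite -(pair_big_dep xpredT (fun x y => (x, y) \in E) (fun _ _ => 1)) /=.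
  by apply: eq_bigr => x _; rewrite sum1_card; apply: eq_card => y; rewrite inE.
have dense_d : (m ^ r + s) * n ^ r <= \sum_x d x ^ r.
  rewrite -(leq_pmul2l (_ : 0 < n ^ r')) ?expn_gt0 ?W0 //.
  apply: leq_trans (power_mean d r'); rewrite -cardE; apply: leq_trans dense.
  by rewrite mulnCA -expnD [r' + r]addnC.
pose cin (t : {ffun 'I_r -> W}) := [set x | [forall i, (x, t i) \in E]].
pose bad (t : {ffun 'I_r -> W}) := [set z : {ffun 'I_r -> W} | (#|common_out z| < m) &&
  [forall j, t j \in common_out z]].
have card_tuples (A : {set W}) : #|[set t : {ffun 'I_r -> W} | [forall j, t j \in A]]| = #|A| ^ r.
  rewrite -[r in RHS]card_ord -card_ffun_on; apply: eq_card => t; rewrite inE.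
  by apply/forallP/ffun_onP => h i; have := h i.
have sum_cin : \sum_t #|cin t| = \sum_x d x ^ r.
  under eq_bigr => t _ do rewrite -sum1_card big_mkcond.
  rewrite exchange_big /=; apply: eq_bigr => x _; rewrite -big_mkcond sum1_card /=.
  rewrite -card_tuples; apply: eq_card => t.
  change ((x \in cin t) = (t \in [set t' : {ffun 'I_r -> W} | [forall j, t' j \in [set y | (x, y) \in E]]])).
  rewrite !inE.
  by apply: eq_forallb => i; rewrite inE.
(* A fixed tuple with fewer than [m] common out-neighbours is bad only for samples drawn from these,
   so for at most [m ^ r] of them. *)
have sum_bad : \sum_t #|bad t| <= m ^ r * n ^ r.
  under eq_bigr => t _ do rewrite -sum1_card big_mkcond.
  rewrite exchange_big /= mulnC -[n ^ r](_ : #|{ffun 'I_r -> W}| = _); last by rewrite card_ffun card_ord.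
  rewrite -sum_nat_const; apply: leq_sum => z _; rewrite -big_mkcond sum1_card /=.
  have [lt|ge] := boolP (#|common_out z| < m); last first.
    by rewrite eq_card0 // => t; change ((z \in bad t) = false); rewrite inE (negPf ge).
  apply: leq_trans (_ : #|common_out z| ^ r <= _); last by rewrite leq_exp2r // ltnW.
  rewrite -card_tuples; apply: subset_leq_card; apply/subsetP => t.
  by change (z \in bad t -> t \in [set t' : {ffun 'I_r -> W} | [forall j, t' j \in common_out z]]); rewrite !inE => /andP[].
have [t tP] : exists t, #|bad t| + s <= #|cin t|.
  apply: NNPP => H; suff : \sum_t #|cin t| < \sum_t (#|bad t| + s).
    rewrite sum_cin big_split /= sum_nat_const card_ffun card_ord ltnNge => /negP; apply.
    apply: leq_trans dense_d; rewrite mulnDl [s * _]mulnC leq_add2r //.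
  have [x0 _] := card_gt0P W0.
  rewrite (bigD1 [ffun=> x0]) //= [X in _ < X](bigD1 [ffun=> x0]) //= -addSn.
  by apply: leq_add; [|apply: leq_sum => t _; apply: ltnW]; rewrite ltnNge; apply/negP => h; apply: H; eexists; exact: h.
(* Deleting the first coordinate of each bad tuple destroys it and removes at most [#|bad t|]
   vertices. *)
pose i0 : 'I_r := ord0.
exists (cin t :\: [set z i0 | z : {ffun 'I_r -> W} in bad t]); split.
  rewrite cardsD; apply: leq_trans (_ : #|cin t| - #|bad t| <= _); first by rewrite leq_subRL // (leq_trans (leq_addr _ _) tP).
  by apply: leq_sub2l; apply: leq_trans (leq_imset_card _ _); apply/subset_leq_card/subsetIr.
move=> z zU; rewrite leqNgt; apply/negP => lt.
have := zU i0; rewrite in_setD => /andP[/imsetP H _]; apply: H; exists z => //.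
rewrite inE lt; apply/forallP => j; rewrite inE; apply/forallP => i.
by have := zU i; rewrite in_setD inE => /andP[_ /forallP].
Qed.

End DRC.

Section EmbedWO.
Variables (V W : finType) (HA : {set V * V}).
Hypothesis oriHA : oriented HA.

(** Vertices without in-arcs go into [Us] first; every other vertex of [V1] is then placed in the
    common out-neighbourhood of the images of its at most [r'.+1] in-neighbours. Each choice has at
    least [#|V|] candidates, enough to avoid what is occupied. *)
Lemma embed_well_oriented (U V1 : {set V}) (E : {set W * W}) f r' (Us : {set W}) :
    pcopy HA U (fun _ _ => E) f -> [disjoint U & V1] ->
    (forall x y, (x, y) \in HA -> (x \in V1) = (y \in V1)) ->
    (forall v, v \in V1 -> ~ nwo HA v) ->
    (forall y, y \in V1 -> #|[set x | (x, y) \in HA]| <= r'.+1) ->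
    #|V| <= #|Us| ->
    (forall z : {ffun 'I_r'.+1 -> W}, (forall i, z i \in Us) -> #|V| <= #|common_out E z|) ->
  exists f', pcopy HA (U :|: V1) (fun _ _ => E) f'.
Proof.
move=> cp0 dis cl Vnwo deg cardU comm.
pose L := [set v in V1 | ~~ [exists u, (u, v) \in HA]].
have VU v : v \in V1 -> v \notin U by move=> vV; rewrite (disjointFl dis).
have fresh (S : {set V}) g z (A : {set W}) : z \notin S -> #|V| <= #|A| ->
    exists2 h, h \in A & h \notin g @: S.
  move=> zS cA; have := leq_trans (card_imset_lt g zS) cA => lt.
  apply: NNPP => H; move: lt; rewrite ltnNge => /negP; apply.
  apply/subset_leq_card/subsetP => h hA; apply/negPn/negP => hS; apply: H; by exists h.
have [f1 [cp1 f1U]] : exists f1, pcopy HA (U :|: [set v in enum L]) (fun _ _ => E) f1 /\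
    (forall v, v \in L -> f1 v \in Us).
  have : {subset enum L <= L} by move=> v; rewrite mem_enum.
  suff main (s : seq V) : {subset s <= L} -> exists f1,
      pcopy HA (U :|: [set v in s]) (fun _ _ => E) f1 /\ (forall v, v \in s -> f1 v \in Us).
    move/main => [f1 [h1 h2]]; exists f1; split=> // v vL; apply: h2; by rewrite mem_enum.
  elim: s => [|y s IH] sub; first by exists f; rewrite set_nil setU0.
  have [|g [cpg gU]] := IH; first by move=> v vs; apply: sub; rewrite inE vs orbT.
  have yL : y \in L by apply: sub; rewrite mem_head.
  rewrite set_cons setUCA; set S := U :|: _ in cpg *.
  have [yS|yS] := boolP (y \in S).
    exists g; rewrite (setUidPr _) ?sub1set //; split=> // v; rewrite inE => /predU1P[->|/gU //].
    move: yS; rewrite in_setU inE => /orP[yU|/gU //].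
    by move: yL; rewrite inE => /andP[/VU]; rewrite yU.
  have [h hU hS] := fresh S g y Us yS cardU.
  exists (upd g y h); split; last first.
    move=> v; rewrite inE /upd; case: eqP => //= _; exact: gU.
  have nbr x : x \in S -> ((x, y) \notin HA) * ((y, x) \notin HA).
    move=> xS; move: (yL); rewrite inE negb_exists => /andP[yV /forallP yin].
    split; first exact: yin.
    apply/negP => yx; move: xS; rewrite in_setU inE => /orP[xU|xs].
      by have := cl _ _ yx; rewrite yV => /esym/VU; rewrite xU.
    have : x \in L by apply: sub; rewrite inE xs orbT.
    by rewrite inE negb_exists => /andP[_ /forallP /(_ y)]; rewrite yx.
  by apply: pcopy_upd => // x xS; rewrite ?(negPf (nbr x xS).1) ?(negPf (nbr x xS).2).
set S0 := U :|: [set v in enum L] in cp1.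
suff main (s : seq V) : {subset s <= V1} -> exists g,
    pcopy HA (S0 :|: [set v in s]) (fun _ _ => E) g /\ (forall v, v \in L -> g v \in Us).
  have [|g [cpg _]] := main (enum V1); first by move=> v; rewrite mem_enum.
  exists g; suff -> : U :|: V1 = S0 :|: [set v in enum V1] by [].
  apply/setP => v; rewrite !inE !mem_enum !inE.
  by case: (v \in U); case: (v \in V1); rewrite /= ?orbT.
elim: s => [|y s IH] sub; first by exists f1; rewrite set_nil setU0.
have [|g [cpg gU]] := IH; first by move=> v vs; apply: sub; rewrite inE vs orbT.
have yV : y \in V1 by apply: sub; rewrite mem_head.
rewrite set_cons setUCA; set S := S0 :|: _ in cpg *.
have [yS|yS] := boolP (y \in S).
  have -> : y |: S = S by apply/setUidPr; rewrite sub1set.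
  by exists g; split.
have LS v : v \in L -> v \in S by move=> vL; rewrite !inE mem_enum vL orbT.
have yL : y \notin L by apply: contra yS; apply: LS.
have [x0 x0y] : exists x, (x, y) \in HA.
  by move: yL; rewrite inE yV negbK /= => /existsP.
have inL x : (x, y) \in HA -> x \in L.
  move=> xy; have xV : x \in V1 by rewrite (cl _ _ xy).
  rewrite inE xV negb_exists; apply/forallP => u; apply/negP => ux.
  by case: (Vnwo x xV); split; [exists u|exists y].
pose X := [set x | (x, y) \in HA].
(* If [y] has fewer than [r'.+1] in-neighbours, the tuple is padded with the image of [x0]. *)
pose z : {ffun 'I_r'.+1 -> W} := [ffun i : 'I_r'.+1 => nth (g x0) (map g (enum X)) i].
have [|h hz hS] := fresh S g y (common_out E z) yS.
  apply: comm => i; rewrite ffunE.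
  have : nth (g x0) (map g (enum X)) i \in g x0 :: map g (enum X).
    have [lt|ge] := ltnP i (size (map g (enum X))); last by rewrite nth_default ?mem_head.
    by rewrite inE mem_nth // orbT.
  rewrite inE => /predU1P[->|/mapP[x xX ->]]; apply/gU/inL => //.
  by move: xX; rewrite mem_enum inE.
exists (upd g y h); split; last first.
  by move=> v vL; rewrite /upd ifN ?gU //; apply: contraTneq vL => ->.
apply: pcopy_upd => // x xS xy; last first.
  by case: (Vnwo y yV); split; [exists x0|exists x].
have xX : x \in enum X by rewrite mem_enum inE.
have ltx : index x (enum X) < r'.+1.
  by apply: leq_trans (deg y yV); rewrite cardE index_mem.
move: hz; rewrite inE => /forallP /(_ (Ordinal ltx)); rewrite ffunE /=.
by rewrite (nth_map x0) ?index_mem // nth_index.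
Qed.

End EmbedWO.

(** * The streaming algorithm *)

Section Peeling.
Variables (W : finType).
Implicit Types (F Q K : {set W * W}).

Definition richb d Q := [forall e in Q,
  (d <= #|[set e' in Q | e'.1 == e.1]|) && (d <= #|[set e' in Q | e'.2 == e.2]|)].

Lemma richP d Q : reflect (rich d Q) (richb d Q).
Proof.
apply: (iffP forallP) => h e; first by move=> eQ; have /implyP/(_ eQ)/andP := h e.
by apply/implyP => /h /andP.
Qed.

(** A degeneracy condition on [F], viewed as a bipartite graph between tails and heads. *)
Definition peelable d F := forall Q, Q \subset F -> Q != set0 -> ~~ richb d Q.

(** A nonempty peelable set has a tail or a head with at most [d] arcs; deleting these removes that
    vertex from the tails or the heads, which pays for them. *)
Lemma peelable_card d F : peelable d.+1 F ->
  #|F| <= d * (#|[set e.1 | e in F]| + #|[set e.2 | e in F]|).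
Proof.
have [m] := ubnP #|F|; elim: m F => // m IH F Fm pF.
have [->|F0] := eqVneq F set0; first by rewrite cards0.
have := pF F (subxx _) F0; rewrite negb_forall => /existsP[[x y]].
rewrite negb_imply negb_and -!ltnNge !ltnS /= => /andP[xyF small].
have peel (D : {set W * W}) (X X' Y Y' : {set W}) : (x, y) \in D -> #|D| <= d ->
    D \subset F ->
    X' = [set e.1 | e in F :\: D] -> X = [set e.1 | e in F] ->
    Y' = [set e.2 | e in F :\: D] -> Y = [set e.2 | e in F] ->
    #|X'| + #|Y'| < #|X| + #|Y| -> #|F| <= d * (#|X| + #|Y|).
  move=> xyD cD DF eX' eX eY' eY lt; rewrite -(cardsID D F) (setIidPr DF).
  apply: leq_trans (leq_mul (leqnn d) lt); rewrite mulnS; apply: leq_add => //.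
  rewrite eX' eY'; apply: IH.
    rewrite ltnS in Fm; apply: leq_trans Fm; rewrite cardsD (setIidPr DF).
    rewrite ltn_subrL; apply/andP; split; apply/card_gt0P; exists (x, y) => //.
  by move=> Q QF; apply: pF; apply: subset_trans QF (subsetDl _ _).
have sub1 D : [set e.1 | e in F :\: D] \subset [set e.1 | e in F].
  exact/imsetS/subsetDl.
have sub2 D : [set e.2 | e in F :\: D] \subset [set e.2 | e in F].
  exact/imsetS/subsetDl.
case/orP: small => sm; (apply: (peel _ _ _ _ _ _ sm _ (erefl _) (erefl _) (erefl _) (erefl _));
  [by rewrite inE xyF /= | by apply/subsetP => e; rewrite inE => /andP[] | ]).
  rewrite -addSn; apply: leq_add; last exact/subset_leq_card/sub2.
  apply: proper_card; apply/properP; split=> //; exists x; first by apply/imsetP; exists (x, y).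
  by apply/imsetP => -[e]; rewrite !inE => /andP[+ eF] ex; rewrite eF -ex eqxx.
rewrite -addnS; apply: leq_add; first exact/subset_leq_card/sub1.
apply: proper_card; apply/properP; split=> //; exists y; first by apply/imsetP; exists (x, y).
by apply/imsetP => -[e]; rewrite !inE => /andP[+ eF] ex; rewrite eF -ex eqxx.
Qed.

Variables (d M : nat).
Hypothesis d_gt0 : 0 < d.

(* An arc is dropped only when it would close a subgraph of minimum in- and
   out-degree above [d]; the first [M] arcs are kept unconditionally. *)
Definition redundant K a :=
  [exists Q : {set W * W}, [&& Q \subset a |: K, a \in Q & richb d.+1 Q]].

Definition kstep K a := if (M <= #|K|) && redundant K a then K else a |: K.

(** [E] absorbs the arcs kept unconditionally; the rest is linear in number by [peelable_card]. *)
Definition kinv K := exists E : {set W * W}, #|E| <= M /\ peelable d.+1 (K :\: E).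

Lemma kinv0 : kinv set0.
Proof.
exists set0; rewrite cards0; split=> // Q; rewrite setD0 subset0 => /eqP ->.
by rewrite eqxx.
Qed.

Lemma kinv_step K a : kinv K -> kinv (kstep K a).
Proof.
move=> [E [EM pE]]; rewrite /kstep; case: ifP => h; first by exists E.
have [ge|lt] := leqP M #|K|; last first.
  exists (a |: K); split; first by apply: leq_trans lt; rewrite cardsU1; case: (_ \notin _); rewrite // leqW.
  by move=> Q; rewrite setDv subset0 => /eqP ->; rewrite eqxx.
exists E; split=> // Q QK Q0; apply/negP => rQ; move: h; rewrite ge /= => /existsP [].
have [aQ|aQ] := boolP (a \in Q).
  by exists Q; rewrite aQ rQ (subset_trans QK (subsetDl _ _)).
have QKE : Q \subset K :\: E.
  apply/subsetP => e eQ; have := subsetP QK e eQ.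
  rewrite !inE => /andP[-> /predU1P[e'|->]] //; by rewrite -e' eQ in aQ.
by have := pE Q QKE Q0; rewrite rQ.
Qed.

Lemma kinv_card K : kinv K -> #|K| <= M + d * (#|W| + #|W|).
Proof.
move=> [E [EM /peelable_card pE]]; rewrite -(cardsID E K); apply: leq_add.
  by apply: leq_trans EM; apply/subset_leq_card/subsetIr.
by apply: leq_trans pE _; rewrite leq_mul2l leq_add ?orbT ?max_card.
Qed.

(* [G] is the set of arcs read so far and [K] the set of arcs kept. *)
Definition kgood (G K : {set W * W}) := [/\ K \subset G, #|K| < M -> K = G &
  forall x y, (x, y) \in G -> (x, y) \notin K -> exists Q : {set W * W},
    [/\ rich d Q, Q \subset K, exists w, (x, w) \in Q & exists w, (w, y) \in Q]].

(** Removing [a] from its witness [Q] costs at most one at each degree, hence [d.+1] in the test and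
    [d] here; as [d] is positive, other arcs of [Q] share the tail and the head of [a]. *)
Lemma kgood_step G K a : kgood G K -> kgood (a |: G) (kstep K a).
Proof.
move=> [KG full red]; rewrite /kstep.
have grow : forall x y, (x, y) \in G -> (x, y) \notin a |: K -> exists Q : {set W * W},
    [/\ rich d Q, Q \subset a |: K, exists w, (x, w) \in Q & exists w, (w, y) \in Q].
  move=> x y xyG xyK; have [|Q [? QK ? ?]] := red x y xyG.
    by apply: contra xyK => ?; rewrite setU1r.
  by exists Q; split=> //; apply: subset_trans QK (subsetUr _ _).
case: ifP => [/andP[ge /existsP[Q /and3P[QK aQ /richP rQ]]]|_]; last first.
  split; first exact: setUS.
    move=> lt; congr (_ |: _); apply: full; apply: leq_ltn_trans lt.
    exact/subset_leq_card/subsetUr.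
  by move=> x y /setU1P[->|]; [rewrite setU11|apply: grow].
split; first exact: subset_trans KG (subsetUr _ _).
  by rewrite ltnNge ge.
move=> x y /setU1P[ea _|]; last exact: red.
have QK' : Q :\ a \subset K.
  apply/subsetP => e; rewrite in_setD1 => /andP[ne /(subsetP QK)].
  by case/setU1P => // e'; rewrite e' eqxx in ne.
have drop (P : pred (W * W)) m : m < #|[set e' in Q | P e']| -> m <= #|[set e' in Q :\ a | P e']|.
  rewrite (cardsD1 a) => h; rewrite -ltnS (leq_trans h) //.
  apply: leq_trans (_ : 1 + #|[set e' in Q :\ a | P e']| <= _) => //.
  apply: leq_add; first by case: (_ \in _).
  by apply/subset_leq_card/subsetP => e; rewrite !inE andbA.
have rQ' : rich d (Q :\ a).
  by move=> e; rewrite in_setD1 => /andP[_ /rQ [h1 h2]]; split; apply: drop.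
exists (Q :\ a); split=> //; have [/drop h1 /drop h2] := rQ a aQ.
  have /card_gt0P[[u w]] := leq_trans d_gt0 h1.
  rewrite in_set => /andP[uw /eqP /= eu]; exists w.
  by rewrite (_ : x = u) // eu -ea.
have /card_gt0P[[w u]] := leq_trans d_gt0 h2.
rewrite in_set => /andP[uw /eqP /= eu]; exists w.
by rewrite (_ : y = u) // eu -ea.
Qed.

Lemma kgood_foldl (s : seq (W * W)) : kgood [set a in s] (foldl kstep set0 s).
Proof.
suff main G K : kgood G K -> kgood (G :|: [set a in s]) (foldl kstep K s).
  rewrite -[X in kgood X _]set0U; apply: main; split=> // x y; by rewrite inE.
elim: s G K => [|a s IH] G K /= good; first by rewrite set_nil setU0.
rewrite set_cons setUCA setUA; apply: IH; exact: kgood_step.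
Qed.

End Peeling.

(** * Storing sets of arcs in memory *)

Section Deterministic.
Variables (V : finType) (HA : {set V * V}) (n S B : nat).
Let arc := ('I_n * 'I_n)%type.
Variables (step : {set arc} -> arc -> {set arc}) (out : {set arc} -> option {set 'I_n}).
Variable inv : {set arc} -> Prop.
Hypothesis inv0 : inv set0.
Hypothesis inv_step : forall K a, inv K -> inv (step K a).
Hypothesis inv_card : forall K, inv K -> #|K| <= B.
Hypothesis room : (n * n).+1 ^ B <= 2 ^ S.

(** Tables with [B] optional entries represent every set of at most [B] arcs, and there are exactly
    [(n * n).+1 ^ B] of them. *)
Let table := {ffun 'I_B -> option arc}.
Let entries (t : table) : {set arc} := [set a | [exists i, t i == Some a]].

Let tabulate (K : {set arc}) : table := odflt [ffun=> None] [pick t | entries t == K].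

Let tabulateK K : inv K -> entries (tabulate K) = K.
Proof.
move=> /inv_card leB; rewrite /tabulate; case: pickP => [t /eqP //|none].
have := none [ffun i : 'I_B => nth None (map Some (enum K)) i]; case/eqP.
apply/setP => a; rewrite inE; apply/existsP/idP => [[i]|aK].
  rewrite ffunE => /eqP e; have lt : i < size (map Some (enum K)).
    by rewrite ltnNge; apply/negP => ge; rewrite nth_default in e.
  have := mem_nth None lt; rewrite e => /mapP[a' + [->]]; by rewrite mem_enum.
have lt : index a (enum K) < B by apply: leq_trans leB; rewrite cardE index_mem mem_enum.
exists (Ordinal lt); rewrite ffunE /= (nth_map a) ?index_mem ?mem_enum //.
by rewrite nth_index // mem_enum.
Qed.

Let room' : #|table| <= Nat.pow 2 S.
Proof. by rewrite card_ffun card_option card_prod !card_ord pow_expn. Qed.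

Let enc K := code room' (tabulate K).
Let dec (m : 'I_(Nat.pow 2 S)) := entries (odflt [ffun=> None] (uncode table m)).

Let encK K : inv K -> dec (enc K) = K.
Proof. by move=> iK; rewrite /dec /enc codeK /= tabulateK. Qed.

(** The invariant bounds every intermediate set, so decoding an encoded state loses nothing and the
    run simulates [step] exactly; the distribution is a point mass. *)
Lemma deterministic_solves :
    (forall GA : {set arc}, oriented GA -> forall s, perm_eq s (enum GA) ->
       correctb HA GA (out (foldl step set0 s))) ->
  solves HA n S.
Proof.
move=> correct.
pose alg := DetAlg (enc set0) (fun m a => enc (step (dec m) a)) (fun m => out (dec m)).
have runE s : run alg s = out (foldl step set0 s).
  rewrite /run /=; congr (out _).
  elim: s (set0 : {set arc}) inv0 => [|a s IH] K iK /=; first exact: encK.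
  by rewrite encK //; apply/IH/inv_step.
exists [:: (1%R, alg)]; split.
  by split; [constructor => //=; lra|rewrite /=; lra].
by move=> GA oGA s sG; rewrite /success_prob; cbn [List.fold_right fst snd]; rewrite runE correct //; lra.
Qed.

End Deterministic.

(** * The kept arcs preserve the existence of a copy *)

Section Reversal.
Variables (V W : finType).

Definition revs (T : finType) (A : {set T * T}) := [set (e.2, e.1) | e in A].

Lemma in_revs (T : finType) (A : {set T * T}) x y : ((x, y) \in revs A) = ((y, x) \in A).
Proof.
apply/imsetP/idP => [[[u v] uv [-> ->]] //|yx]; by exists (y, x).
Qed.

Lemma card_revs (T : finType) (A : {set T * T}) : #|revs A| = #|A|.
Proof. by apply: card_imset => -[x y] [x' y'] [-> ->]. Qed.

Lemma oriented_revs (A : {set V * V}) : oriented A -> oriented (revs A).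
Proof. by move=> oA x y; rewrite !in_revs => /oA; rewrite eq_sym. Qed.

Lemma nwo_revs (A : {set V * V}) v : nwo (revs A) v -> nwo A v.
Proof. by move=> [[u vu] [w wv]]; rewrite !in_revs in vu wv; split; [exists w|exists u]. Qed.

Lemma pcopy_revs (A : {set V * V}) (U : {set V}) (K : {set W * W}) f :
  pcopy (revs A) U (fun _ _ => revs K) f <-> pcopy A U (fun _ _ => K) f.
Proof.
split=> -[finj farc]; split=> // x y xU yU; first by rewrite -in_revs => /farc; rewrite in_revs; apply.
by rewrite !in_revs; apply: farc.
Qed.

End Reversal.

Section Kernel.
Variables (V W : finType) (HA : {set V * V}).
Hypothesis oriHA : oriented HA.
Hypothesis nwo_inj : forall u v, nwo HA u -> nwo HA v -> connect (uadj HA) u v -> u = v.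
Hypothesis nwo_acyclic : forall u, nwo HA u -> ~ comp_has_cycle HA u.

Definition nwo_comps := [set v | [exists u, nwob HA u && connect (uadj HA) u v]].

Lemma nwo_compsP v : reflect (exists2 u, nwo HA u & connect (uadj HA) u v) (v \in nwo_comps).
Proof.
rewrite inE; apply: (iffP existsP) => [[u /andP[/nwoP nu uv]]|[u /nwoP nu uv]]; exists u => //.
by rewrite nu.
Qed.

Lemma nwo_comps_closed z w : uadj HA z w -> (z \in nwo_comps) = (w \in nwo_comps).
Proof.
move=> zw; apply/nwo_compsP/nwo_compsP => -[u nu uz]; exists u => //; apply: connect_trans uz _.
  exact: connect1.
by apply: connect1; rewrite uadj_sym.
Qed.

Lemma nwo_comps_acyclic z : z \in nwo_comps -> ~ in_cycle HA z.
Proof.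
move/nwo_compsP => [u nu uz] [cyc h1 h2]; case: (nwo_acyclic nu).
by exists cyc; split=> //; exists z.
Qed.

Lemma kernel_nwo_comps M (G K : {set W * W}) f :
    kgood #|V| M G K -> pcopy HA nwo_comps (fun _ _ => G) f ->
  exists f', pcopy HA nwo_comps (fun _ _ => K) f'.
Proof.
move=> [KG _ red]; apply: (tree_kernel oriHA) => //.
- by move=> z w zU zw; rewrite -(nwo_comps_closed zw).
- exact: nwo_comps_acyclic.
- by move=> u v _; apply: nwo_inj.
Qed.

Lemma kernel_forest M (G K : {set W * W}) f : is_forest HA ->
    kgood #|V| M G K -> pcopy HA setT (fun _ _ => G) f ->
  exists f', pcopy HA setT (fun _ _ => K) f'.
Proof.
move=> forest [KG _ red]; apply: (tree_kernel oriHA) => //.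
  by move=> z _ [cyc h _]; apply: forest; exists cyc.
by move=> u v _; apply: nwo_inj.
Qed.

(* The well-oriented components split into those whose sinks and those whose
   sources lie on the side [alpha] of bounded degree; dependent random choice
   applies to the former, and to the latter after reversing all arcs. *)
Lemma kernel_mixed (c : V -> bool) alpha r' M (G K : {set W * W}) f :
    bip_coloring HA c -> (forall v, c v = alpha -> udeg HA v <= r'.+1) ->
    0 < #|W| -> (#|V| ^ r'.+1 + #|V|) * #|W| ^ (r'.+1 + r') <= M ^ r'.+1 ->
    kgood #|V| M G K -> pcopy HA setT (fun _ _ => G) f ->
  exists f', pcopy HA setT (fun _ _ => K) f'.
Proof.
move=> colc deg W0 dense good cpf.
(* Below [M] kept arcs nothing has been dropped; otherwise [K] is dense enough for dependent random
   choice. *)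
have [ltM|geM] := ltnP #|K| M.
  by have [_ /(_ ltM) -> _] := good; exists f.
have denseK : (#|V| ^ r'.+1 + #|V|) * #|W| ^ (r'.+1 + r') <= #|K| ^ r'.+1.
  by apply: leq_trans dense _; rewrite leq_exp2r.
have [f0 cp0] : exists f', pcopy HA nwo_comps (fun _ _ => K) f'.
  apply: (kernel_nwo_comps (f := f) good); split=> [x y _ _|x y _ _]; [apply: (proj1 cpf)|apply: (proj2 cpf)]; by rewrite ?in_setT.
pose tail v := [exists w, (v, w) \in HA].
pose head v := [exists u, (u, v) \in HA].
have tailI v w : (v, w) \in HA -> tail v by move=> h; apply/existsP; exists w.
have headI v u : (u, v) \in HA -> head v by move=> h; apply/existsP; exists u.
have not_both v : v \notin nwo_comps -> tail v -> head v -> False.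
  move=> /nwo_compsP vN /existsP[w vw] /existsP[u uv]; apply: vN; exists v => //.
  by split; [exists u|exists w].
(* [V1] takes the components with sources off the side [alpha] and sinks on it, and with them the
   isolated vertices. *)
pose V1 := [set v | [&& v \notin nwo_comps, tail v ==> (c v == ~~ alpha) & head v ==> (c v == alpha)]].
pose V2 := [set v | (v \notin nwo_comps) && (v \notin V1)].
have cl0 x y : (x, y) \in HA -> (x \in nwo_comps) = (y \in nwo_comps).
  by move=> xy; apply: nwo_comps_closed; rewrite /uadj xy.
have cl1 x y : (x, y) \in HA -> (x \in V1) = (y \in V1).
  move=> xy; rewrite /V1 in_set [RHS]in_set (cl0 _ _ xy); have [//|yN] := boolP (y \in nwo_comps).
  have xN : x \notin nwo_comps by rewrite (cl0 _ _ xy).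
  have hx : head x = false by apply: negbTE; apply/(introN idP) => h; exact: (not_both x xN (tailI _ _ xy) h).
  have ty : tail y = false by apply: negbTE; apply/(introN idP) => t; exact: (not_both y yN t (headI _ _ xy)).
  rewrite hx ty (tailI _ _ xy) (headI _ _ xy) /= andbT; have := colc _ _ xy.
  by case: (c x); case: (c y); case: (alpha).
have cl2 x y : (x, y) \in HA -> (x \in V2) = (y \in V2).
  by move=> xy; rewrite /V2 in_set [RHS]in_set (cl0 _ _ xy) (cl1 _ _ xy).
have N1 v : v \in V1 -> v \notin nwo_comps by rewrite in_set => /and3P[].
have N2 v : v \in V2 -> v \notin nwo_comps by rewrite in_set => /andP[].
have noN v : v \notin nwo_comps -> ~ nwo HA v.
  by move=> vN nv; case/negP: vN; apply/nwo_compsP; exists v; rewrite ?connect0.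
have [Us [cUs comm]] := dependent_random_choice W0 denseK.
have [|||f1 cp1] := embed_well_oriented (V1 := V1) oriHA cp0 _ cl1 _ _ cUs comm.
- by rewrite disjoint_sym disjoint_subset; apply/subsetP => v /N1.
- by move=> v /N1/noN.
- move=> y yV; have [/eqP cy|cy] := boolP (c y == alpha).
    apply: leq_trans (deg y cy); apply/subset_leq_card/subsetP => x.
    by rewrite !inE /uadj => ->; rewrite orbT.
  rewrite (_ : [set x | _] = set0) ?cards0 //; apply/setP => x; rewrite !inE.
  apply/negP => /headI hy; move: yV; rewrite in_set => /and3P[_ _ /implyP /(_ hy)].
  by rewrite (negPf cy).
have denseR : (#|V| ^ r'.+1 + #|V|) * #|W| ^ (r'.+1 + r') <= #|revs K| ^ r'.+1.
  by rewrite card_revs.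
have [Ur [cUr commr]] := dependent_random_choice W0 denseR.
have [||||f2 /pcopy_revs cp2] := embed_well_oriented (V1 := V2) (oriented_revs oriHA)
  (proj2 (pcopy_revs HA _ K f1) cp1) _ _ _ _ cUr commr.
- rewrite disjoint_sym disjoint_subset; apply/subsetP => v vV2.
  change (v \notin nwo_comps :|: V1); rewrite in_setU negb_or (N2 _ vV2).
  by move: vV2; rewrite in_set => /andP[].
- by move=> x y; rewrite in_revs => /cl2.
- by move=> v /N2/noN h /nwo_revs.
- move=> y yV; have [/eqP cy|cy] := boolP (c y == alpha).
    apply: leq_trans (deg y cy); apply/subset_leq_card/subsetP => x.
    by rewrite !inE in_revs /uadj => ->.
  rewrite (_ : [set x | _] = set0) ?cards0 //; apply/setP => x; rewrite !inE in_revs.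
  apply/negP => /tailI ty; have := N2 _ yV => yN; have := not_both _ yN ty => hy.
  move: yV; rewrite in_set yN in_set yN /= ty /=; case: (head y) hy => [[]//|] _ /=.
  by rewrite andbT; move: cy; case: (c y); case: (alpha).
exists f2; suff -> : setT = nwo_comps :|: V1 :|: V2 by [].
by apply/setP => v; rewrite /V2 in_setT !in_setU in_set; case: (v \in nwo_comps); case: (v \in V1).
Qed.

End Kernel.

Lemma copyb_pcopy (V : finType) (HA : {set V * V}) n (G : {set 'I_n * 'I_n}) (f : {ffun V -> 'I_n}) :
  copyb HA G f <-> pcopy HA setT (fun _ _ => G) f.
Proof.
split=> [/andP[/injectiveP finj /forallP farc]|[finj farc]].
  split=> [x y _ _|x y _ _ xy]; first exact: finj.
  by have /implyP := farc (x, y); apply.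
apply/andP; split; first by apply/injectiveP => x y; apply: finj; rewrite in_setT.
by apply/forallP => -[x y]; apply/implyP => xy; apply: farc; rewrite ?in_setT.
Qed.

Lemma kernel_solves (V : finType) (HA : {set V * V}) n M S : 0 < #|V| ->
    (forall (G K : {set 'I_n * 'I_n}) f, kgood #|V| M G K ->
       pcopy HA setT (fun _ _ => G) f -> exists f', pcopy HA setT (fun _ _ => K) f') ->
    (n * n).+1 ^ (M + #|V| * (n + n)) <= 2 ^ S ->
  solves HA n S.
Proof.
move=> V0 kernel room.
pose out (K : {set 'I_n * 'I_n}) : option {set 'I_n} :=
  omap (fun f : {ffun V -> 'I_n} => f @: [set: V]) [pick f | copyb HA K f].
apply: (@deterministic_solves _ _ _ _ _ (kstep #|V| M) out (kinv #|V| M) _ _ _ room).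
- exact: kinv0.
- by move=> K a; apply: kinv_step.
- by move=> K /kinv_card; rewrite card_ord.
move=> GA _ s sG; set K := foldl _ _ _.
have good : kgood #|V| M GA K.
  rewrite (_ : GA = [set a in s]); first exact: kgood_foldl.
  by apply/setP => a; rewrite inE (perm_mem sG) mem_enum.
rewrite /out; case: pickP => [f cpf|none] /=.
  apply/existsP; exists f; rewrite eqxx andbT; apply/copyb_pcopy.
  move/copyb_pcopy: cpf => [finj farc]; split=> // x y xT yT xy.
  by have [KG _ _] := good; apply: (subsetP KG); apply: farc.
apply/existsP => -[f /copyb_pcopy /(kernel _ _ _ good) [f' [finj farc]]].
have := none (finfun f'); case/negP; apply/copyb_pcopy.
split=> [x y xT yT|x y xT yT xy]; rewrite !ffunE; [exact: finj|exact: farc].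
Qed.

(** * Numerical estimates of the space *)

Lemma log2_table_size n B : (n * n).+1 ^ B <= 2 ^ ((up_log 2 n).*2.+1 * B).
Proof.
rewrite expnM; case: B => // B; rewrite leq_exp2r //.
have := @up_logP 2 n isT => /leq_mul - /(_ _ _ (up_logP n (ltnSn 1))).
rewrite -expnD addnn expnS; have := expn_gt0 2 (up_log 2 n).*2.
by move: (2 ^ _) => X /= X0 nX; lia.
Qed.

Lemma INR_expn m n : INR (m ^ n) = (INR m ^ n)%R.
Proof. by elim: n => //= n IH; rewrite expnS INR_muln IH. Qed.

Lemma ln_nondecreasing x y : (0 < x)%R -> (x <= y)%R -> (ln x <= ln y)%R.
Proof.
move=> x0 [lt|->]; [exact/Rlt_le/ln_increasing|exact: Rle_refl].
Qed.

Lemma ln_ge1 n : 3 <= n -> (1 <= ln (INR n))%R.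
Proof.
move/INR_leq => /= n3; rewrite -(ln_exp 1); have := exp_le_3; have := exp_pos 1.
by move=> h1 h2; apply: ln_nondecreasing; lra.
Qed.

Lemma INR_bits n : 3 <= n -> (INR (up_log 2 n).*2.+1 <= 7 * ln (INR n))%R.
Proof.
move=> n3; have l1 := ln_ge1 n3.
have lo : (INR (up_log 2 n).-1 * ln 2 <= ln (INR n))%R.
  rewrite -ln_pow; last lra.
  apply: ln_nondecreasing; first by apply: pow_lt; lra.
  have -> : (2 ^ (up_log 2 n).-1)%R = INR (2 ^ (up_log 2 n).-1) by rewrite INR_expn.
  by apply/INR_leq/ltnW/up_log_gtn => //; apply: leq_trans n3.
have u0 : 0 < up_log 2 n by rewrite up_log_gt0 //; lia.
(* The first summand is at most [4 * ln n] because [ln 2 > 1 / 2], and [3 <= 3 * ln n]. *)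
have -> : (up_log 2 n).*2.+1 = 2 * (up_log 2 n).-1 + 3 by lia.
rewrite INR_addn INR_muln /=; have := ln_lt_2; have := pos_INR (up_log 2 n).-1; nra.
Qed.

Lemma exponent_ge1 r' : (1 <= 2 - 1 / INR r'.+1)%R.
Proof.
have r1 : (1 <= INR r'.+1)%R by apply: (@INR_leq 1).
have := Rinv_le_contravar 1 (INR r'.+1) ltac:(lra) r1.
rewrite Rinv_1 /Rdiv Rmult_1_l; lra.
Qed.

(** [z] is the power rounded up to an integer; rounding costs at most one, which the factor [2]
    absorbs because the power is at least [1]. *)
Lemma ceil_root n r' : 0 < n -> exists z, n ^ (r'.+1 + r') <= z ^ r'.+1 /\
  (INR z <= 2 * Rpower (INR n) (2 - 1 / INR r'.+1))%R.
Proof.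
move=> n0; set r := r'.+1; set R0 := Rpower _ _.
have nR : (1 <= INR n)%R by apply: (INR_leq n0).
have r1 : (1 <= INR r)%R by apply: (@INR_leq 1).
have R0r : (R0 ^ r = INR n ^ (r + r'))%R.
  rewrite -Rpower_pow; last exact: exp_pos.
  rewrite /R0 Rpower_mult -Rpower_pow; last lra.
  congr Rpower; rewrite INR_addn {3}/r S_INR.
  have -> : INR r' = (INR r - 1)%R by rewrite /r S_INR; lra.
  by field; lra.
have R01 : (1 <= R0)%R.
  rewrite -(Rpower_O (INR n)); last lra.
  by apply: Rle_Rpower; [lra|have := exponent_ge1 r'; rewrite -/r; lra].
have ex : exists z, n ^ (r + r') <= z ^ r.
  by exists (n ^ (r + r')); rewrite -{1}(expn1 (n ^ _)) leq_pexp2l // expn_gt0 n0.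
case: (ex_minnP ex) => z hz zmin; exists z; split=> //.
case: z hz zmin => [|z] hz zmin; first by rewrite /=; lra.
have lt : z ^ r < n ^ (r + r').
  by rewrite ltnNge; apply/negP => /zmin; rewrite ltnn.
suff : (INR z <= R0)%R by rewrite S_INR; lra.
apply: Rnot_lt_le => gt.
have := pow_incr R0 (INR z) r (conj _ (Rlt_le _ _ gt)) => /(_ ltac:(lra)).
rewrite R0r -!INR_expn => /INR_le /leP; by rewrite leqNgt lt.
Qed.

Theorem theorem7 (V : finType) (HA : {set V * V}) :
  oriented HA -> 3 <= #|V| -> is_bipartite HA -> ~ well_oriented HA ->
  let case1 :=
    (exists u v : V, [/\ u != v, nwo HA u, nwo HA v & connect (uadj HA) u v])
    \/ (exists u : V, nwo HA u /\ comp_has_cycle HA u) in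
  (case1 ->
     exists (c : R) (N : nat), (0 < c)%R /\
       forall n S : nat, N <= n -> solves HA n S -> (c * INR n ^ 2 <= INR S)%R)
  /\ (~ case1 -> is_forest HA ->
       exists (C : R) (k N : nat), forall n : nat, N <= n ->
         exists S : nat, solves HA n S /\ (INR S <= C * INR n * ln (INR n) ^ k)%R)
  /\ (~ case1 -> ~ is_forest HA ->
       (forall u : V, comp_ok HA u) /\
       forall c : V -> bool, bip_coloring HA c ->
       exists (C : R) (k N : nat), forall n : nat, N <= n ->
         exists S : nat, solves HA n S /\
           (INR S <= C * Rpower (INR n) (2 - 1 / INR (Delta' HA c)) * ln (INR n) ^ k)%R).
Proof.
move=> oriHA V3 _ _ case1.
have V0 : 0 < #|V| by apply: leq_trans V3.
have nwo_inj : ~ case1 -> forall u v, nwo HA u -> nwo HA v -> connect (uadj HA) u v -> u = v.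
  by move=> n1 u v nu nv uv; apply/eqP/negPn/negP => ne; apply: n1; left; exists u, v.
have nwo_acyclic : ~ case1 -> forall u, nwo HA u -> ~ comp_has_cycle HA u.
  by move=> n1 u nu cyc; apply: n1; right; exists u.
split; [|split].
(* The threshold ensures [n <= 12 * k], so [k ^ 2 <= 2 * S] yields the constant [2 * 144]. *)
- move=> c1; exists (/ 288)%R, (2 * #|V| + 12); split; first lra.
  move=> n S le_n sol; set k := (n - #|V|) %/ 6.
  have k2 : k ^ 2 <= 2 * S.
    apply: sub_lower_bound c1 _ sol => //; rewrite mulnC.
    by have := leq_divM (n - #|V|) 6; rewrite -/k; lia.
  have nk : n <= 12 * k by have := divn_eq (n - #|V|) 6; have := ltn_mod (n - #|V|) 6; rewrite -/k; lia.
  move/INR_leq: nk; move/INR_leq: k2; rewrite !INR_muln.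
  rewrite (_ : INR 2 = 2%R) // (_ : INR 12 = 12%R); last by rewrite /=; lra.
  by have := pos_INR n; nra.
(* No arc is kept unconditionally here. The constant is [7] from the logarithm times [2 * #|V|] from
   the arcs. *)
- move=> n1 forest; exists (14 * INR #|V|)%R, 1, 3 => n n3.
  exists ((up_log 2 n).*2.+1 * (0 + #|V| * (n + n))); split.
    apply: (kernel_solves (M := 0)) => //; last exact: log2_table_size.
    by move=> G K f; apply: kernel_forest => //; apply: nwo_inj.
  have := INR_bits n3; move: (up_log 2 n).*2.+1 => L hL.
  rewrite add0n !INR_muln INR_addn pow_1.
  have := Rmult_le_compat_r _ _ _ (Rmult_le_pos _ _ (pos_INR #|V|) (pos_INR n)) hL; lra.
move=> n1 nforest; split.
  move=> u; case: (classic (exists2 v, connect (uadj HA) u v & nwo HA v)) => [[v uv nv]|none].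
    right; split.
      move=> [cyc [h [x xc ux]]]; apply: (nwo_acyclic n1 v nv); exists cyc; split=> //.
      by exists x => //; apply: connect_trans ux; rewrite connect_uadj_sym.
    exists v; split=> // w uw nw; apply: (nwo_inj n1) => //.
    by apply: connect_trans uv; rewrite connect_uadj_sym.
  (* Without non-well-oriented vertices, having an out-arc gives the bipartition. *)
  left; exists (fun x => [exists w, (x, w) \in HA]) => x y xy ux.
  apply/andP; split; first by apply/existsP; exists y.
  apply/existsP => -[w yw]; apply: none; exists y.
    by apply: connect_trans ux (connect1 _); rewrite /uadj xy.
  by split; [exists x|exists w].
move=> c colc.
have [x [y xy]] : exists x y, (x, y) \in HA.
  apply: NNPP => H; apply: nforest => -[cyc [/andP[cy _] sz]]; apply: H.
  case: cyc cy sz => [|x [|y s]] //= /andP[/orP[h|h] _] _; by eexists; eexists; exact: h.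
(* [alpha] is the side on which the minimum in [Delta'] is attained. *)
have [alpha deg] : exists alpha, forall v, c v = alpha -> udeg HA v <= Delta' HA c.
  rewrite /Delta'; case: leqP => _; [exists true|exists false] => v cv.
    by apply: (leq_bigmax_cond v).
  by apply: (leq_bigmax_cond v); rewrite cv.
have [r' er] : exists r', Delta' HA c = r'.+1.
  suff : 0 < Delta' HA c by case: (Delta' HA c) => // r' _; exists r'.
  have deg_gt0 u v : uadj HA u v -> 0 < udeg HA u.
    by move=> uv; apply/card_gt0P; exists v; rewrite inE.
  have dx : 0 < udeg HA x by apply: (deg_gt0 x y); rewrite /uadj xy.
  have dy : 0 < udeg HA y by apply: (deg_gt0 y x); rewrite /uadj xy orbT.
  have := colc _ _ xy; rewrite /Delta' leq_min.
  case cx: (c x); case cy: (c y) => // _; apply/andP; split.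
  - exact: leq_trans dx (leq_bigmax_cond _ cx).
  - by apply: leq_trans dy (leq_bigmax_cond _ _); rewrite cy.
  - exact: leq_trans dy (leq_bigmax_cond _ cy).
  - by apply: leq_trans dx (leq_bigmax_cond _ _); rewrite cx.
rewrite er in deg *.
(* The first [a * z] arcs are kept: since [a <= a ^ r'.+1], this meets the density demand of
   [kernel_mixed]. *)
set a := #|V| ^ r'.+1 + #|V|.
exists (14 * INR (a + #|V|))%R, 1, 3 => n n3.
have n0 : 0 < n by apply: leq_trans n3.
have [z [hz zle]] := ceil_root r' n0; set R0 := Rpower _ _ in zle *.
exists ((up_log 2 n).*2.+1 * (a * z + #|V| * (n + n))); split.
  apply: (kernel_solves (M := a * z)) => //; last exact: log2_table_size.
  move=> G K f good; apply: (kernel_mixed oriHA (nwo_inj n1) (nwo_acyclic n1) colc deg) good.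
    by rewrite card_ord.
  have a_le : a <= a ^ r'.+1 by rewrite expnS leq_pmulr // expn_gt0 addn_gt0 V0 orbT.
  by rewrite card_ord expnMn; apply: leq_mul a_le hz.
(* The exponent is at least [1], so the linear number of further arcs is absorbed. *)
have nR0 : (INR n <= R0)%R.
  rewrite -{1}(Rpower_1 (INR n)); last exact/lt_0_INR/ltP.
  apply: Rle_Rpower; [exact: (INR_leq n0)|exact: exponent_ge1].
have := INR_bits n3; move: (up_log 2 n).*2.+1 => L hL.
clearbody a; rewrite !(INR_muln, INR_addn) pow_1.
have hB : (INR a * INR z + INR #|V| * (INR n + INR n) <= 2 * (INR a + INR #|V|) * R0)%R.
  have := Rmult_le_compat_l _ _ _ (pos_INR a) zle.
  have := Rmult_le_compat_l _ _ _ (pos_INR #|V|) nR0; lra.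
have B0 : (0 <= INR a * INR z + INR #|V| * (INR n + INR n))%R.
  by rewrite -INR_addn -!INR_muln -INR_addn; apply: pos_INR.
have := Rmult_le_compat _ _ _ _ (pos_INR L) B0 hL hB; lra.
Qed.
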